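(* (1) For every $\beta\in(0,1)$ and every $c>0$, $\dim_H E(\beta,c)=1$. (2) For every $c\in(0,1]$, $\dim_H F(c)=\tfrac12$.
   Context: For irrational $\omega\in(0,1)$ let $a_1(\omega),a_2(\omega),\dots$ be its continued fraction partial quotients, $\omega=\cfrac{1}{a_1+\cfrac{1}{a_2+\cdots}}$, and let $R_n(\omega)$ be the number of distinct values among $a_1(\omega),\dots,a_n(\omega)$. For $\beta\ge0$, $c>0$ define $E(\beta,c)=\{\omega\in[0,1)\text{ irrational}: \lim_{n\to\infty}R_n(\omega)/n^\beta=c\}$ and $F(c)=E(1,c)=\{\omega: \lim_{n\to\infty}R_n(\omega)/n=c\}$. $\dim_H$ denotes Hausdorff dimension. *)

(* Defs.v *)
From HB Require Import structures.
From mathcomp Require Import all_boot all_order all_algebra.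
From mathcomp Require Import all_classical all_reals all_analysis.
Set Implicit Arguments. Unset Strict Implicit. Unset Printing Implicit Defensive.
Import Order.TTheory GRing.Theory Num.Theory.
Import numFieldNormedType.Exports.
Local Open Scope classical_set_scope.
Local Open Scope ring_scope.

Section Defs.
Variable R : realType.

Definition irrational (x : R) : Prop := ~ exists q : rat, x = ratr q.

Definition gauss (x : R) : R := x^-1 - (Num.floor (x^-1))%:~R.

Definition cf_digit (x : R) (n : nat) : nat :=
  `|Num.floor ((iter n.-1 gauss x)^-1)|%N.

Definition cf_distinct (x : R) (n : nat) : nat :=
  size (undup [seq cf_digit x k | k <- iota 1 n]).

Definition E_set (beta c : R) : set R :=
  [set w | 0 <= w < 1 /\ irrational w /\
     (fun n : nat => (cf_distinct w n)%:R / ((n%:R : R) `^ beta)) @ \oo --> c].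

Definition F_set (c : R) : set R := E_set 1 c.

Local Open Scope ereal_scope.

(** diameter (0 for the empty set, possibly +oo) *)
Definition diam (U : set R) : \bar R :=
  ereal_sup ([set 0] `|` [set (`|x - y|)%:E | x in U & y in U]).

(** contribution diam(U)^s of a covering set (0 for the empty set, 0^0 = 1) *)
Definition hcost (s : R) (U : set R) : \bar R :=
  if asbool (U = set0) then 0
  else match diam U with
       | r%:E => (powR r s)%:E
       | _ => +oo
       end.

Definition hausdorff_delta (s delta : R) (A : set R) : \bar R :=
  ereal_inf [set \sum_(0 <= i <oo) hcost s (U i) | U in
     [set U : nat -> set R | A `<=` \bigcup_i U i /\
                             forall i, diam (U i) <= delta%:E]].

(** H^s(A) = lim_{delta -> 0+} H^s_delta(A) = sup_{delta > 0} H^s_delta(A) *)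
Definition hausdorff_measure (s : R) (A : set R) : \bar R :=
  ereal_sup [set hausdorff_delta s d A | d in [set d : R | (0 < d)%R]].

Definition hausdorff_dim (A : set R) : \bar R :=
  ereal_inf [set s%:E | s in [set s : R | (0 <= s)%R /\ hausdorff_measure s A = 0]].

End Defs.

(* Main.v *)
(* Let f n = c n^beta. Position n is a tick if the number of earlier ticks is at
   most f n - 1. Ticks receive fresh digits and all other positions digits in
   {1..M}; for such digits R_n = f n + O(1).

   Lower bounds: given a cover by sets U_i with sum of diam^s small, put
   g = sum_i r_i^(s-1) * (length of a window of radius about r_i at U_i), a
   nondecreasing function of small total variation. Choosing at every step the
   digit whose cylinder carries the least g-mass per unit of length, the density
   of g grows only by the proportion of length lost in restricting the digits,
   and the limit point avoids every U_i as long as this loss is dominated by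
   (cylinder length)^(s-1). For beta < 1 the k-th fresh digit is M + k, which
   costs a subexponential factor, and M is large; for beta = 1 the fresh digit
   at position n ranges over [2^n, 2^(n+1)), which gives every s < 1/2.

   Upper bound 1/2: a word with at least c n / 2 distinct letters has at least
   c n / 2 - M letters above M; for s > 1/2 the series of b^(-2s) converges and
   its tail beyond M is as small as we please, so the cylinders of these words
   have exponentially small total diam^s. *)
Require Import Defs.
From HB Require Import structures.
From mathcomp Require Import all_boot all_order all_algebra.
From mathcomp Require Import all_classical all_reals all_analysis.
From mathcomp Require Import ring lra zify.
Set Implicit Arguments. Unset Strict Implicit. Unset Printing Implicit Defensive.
Import Order.TTheory GRing.Theory Num.Theory.
Import numFieldNormedType.Exports.
Local Open Scope classical_set_scope.
Local Open Scope ring_scope.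

(** * Continued fractions with prescribed digits *)

(** The inverse branch of the iterated Gauss map coded by [w], with [y] as the tail; the image of
    [0, 1] is the cylinder of [w]. *)
Definition cfval (R : realType) (w : seq nat) (y : R) : R :=
  foldr (fun a z => (a%:R + z)^-1) y w.

(** Branches alternately preserve and reverse order, so the endpoints of a cylinder come in either
    order. *)
Definition between (R : realType) (u x v : R) : Prop :=
  u <= x <= v \/ v <= x <= u.

Lemma cfval_rcons (R : realType) (w : seq nat) (a : nat) (y : R) :
  cfval (rcons w a) y = cfval w (a%:R + y)^-1.
Proof. by rewrite /cfval foldr_rcons. Qed.

Lemma between_invD (R : realType) (a : nat) (u x v : R) :
  (0 < a)%N -> 0 <= u -> 0 <= v ->
  between (a%:R + u)^-1 x (a%:R + v)^-1 -> between u (x^-1 - a%:R) v.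
Proof.
move=> a0 u0 v0; have a0' : (0 : R) < a%:R by rewrite ltr0n.
have key p q : 0 <= p -> 0 <= q -> (a%:R + p)^-1 <= x <= (a%:R + q)^-1 ->
    q <= x^-1 - a%:R <= p.
  move=> p0 q0 /andP[px xq].
  have P : 0 < a%:R + p by lra.
  have Q : 0 < a%:R + q by lra.
  have x0 : 0 < x by apply: lt_le_trans px; rewrite invr_gt0.
  have /andP[h1 h2] : a%:R + q <= x^-1 <= a%:R + p.
    apply/andP; split.
      by rewrite -[X in X <= _]invrK lef_pV2 ?posrE ?invr_gt0.
    by rewrite -[X in _ <= X]invrK lef_pV2 ?posrE ?invr_gt0.
  by apply/andP; split; lra.
by case=> h; [right|left]; exact: key.
Qed.

Lemma invDn_itv (R : realType) (a : nat) (y : R) :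
  (0 < a)%N -> 0 <= y -> 0 <= (a%:R + y)^-1 <= 1.
Proof.
move=> a0 y0; have a1 : (1 : R) <= a%:R by rewrite ler1n.
by apply/andP; split; [rewrite invr_ge0|rewrite invf_le1]; lra.
Qed.

Lemma cfval_itv (R : realType) (w : seq nat) (y : R) :
  all (leq 1) w -> 0 <= y <= 1 -> 0 <= cfval w y <= 1.
Proof.
elim: w => [_ //|a w IH /= /andP[a0 w0] y01].
have /andP[h _] := IH w0 y01.
exact: invDn_itv.
Qed.

Lemma cfval_between (R : realType) (w : seq nat) (y : R) :
  all (leq 1) w -> 0 <= y <= 1 ->
  between (cfval w 0) (cfval w y) (cfval w 1).
Proof.
elim: w => [_ h|a w IH /= /andP[a0 w0] y01]; first by left.
have := IH w0 y01.
have /andP[+ _] := cfval_itv w0 y01.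
have /andP[+ _] := @cfval_itv R w 0 w0 ltac:(lra).
have /andP[+ _] := @cfval_itv R w 1 w0 ltac:(lra).
move: (cfval w 0) (cfval w y) (cfval w 1) => u x v v0 u0 x0.
have a1 : (1 : R) <= a%:R by rewrite ler1n.
have key (p q : R) : 0 <= p -> p <= q -> (a%:R + q)^-1 <= (a%:R + p)^-1.
  by move=> p0 pq; rewrite lef_pV2 ?posrE; lra.
by case=> /andP[h1 h2]; [right|left]; apply/andP; split; apply: key.
Qed.

Lemma mkseq_pos (a : nat -> nat) (n : nat) :
  (forall k, (0 < a k)%N) -> all (leq 1) (mkseq a n).
Proof. by move=> a0; apply/allP => _ /mapP[k _ ->]. Qed.

Lemma mkseqSr (a : nat -> nat) (n : nat) :
  mkseq a n.+1 = rcons (mkseq a n) (a n).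
Proof. by rewrite /mkseq -addn1 iotaD map_cat /= add0n cats1. Qed.

Lemma mkseqSl (a : nat -> nat) (n : nat) :
  mkseq a n.+1 = a 0%N :: mkseq (fun k => a k.+1) n.
Proof.
by rewrite /mkseq /= -[1%N]addn0 iotaDl -map_comp.
Qed.

(** Closed cylinders give a nonempty nested intersection; strict inequalities are recovered in
    [cf_expands_itv]. *)
Definition cf_expands (R : realType) (a : nat -> nat) (x : R) : Prop :=
  forall n, between (cfval (mkseq a n) 0) x (cfval (mkseq a n) 1).

Lemma cf_expands_exists (R : realType) (a : nat -> nat) :
  (forall k, (0 < a k)%N) -> exists x : R, cf_expands a x.
Proof.
move=> a0.
pose L n : R := Num.min (cfval (mkseq a n) 0) (cfval (mkseq a n) 1).
pose U n : R := Num.max (cfval (mkseq a n) 0) (cfval (mkseq a n) 1).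
have LUn n : L n <= U n by rewrite /L /U ge_min le_max lexx.
have bt n y : 0 <= y <= 1 -> L n <= cfval (mkseq a n) y <= U n.
  move=> /(cfval_between (mkseq_pos n a0)); rewrite /L /U /between.
  rewrite ge_min le_max.
  by case=> /andP[h1 h2]; rewrite h1 h2 ?orbT.
(* The endpoints at depth [n.+1] are values of the depth [n] branch at points of [0, 1], so the
   cylinders are nested. *)
have step n : L n <= L n.+1 /\ U n.+1 <= U n.
  rewrite {2}/L {1}/U !mkseqSr !cfval_rcons le_min ge_max.
  have /andP[-> ->] := bt n _ (@invDn_itv R (a n) 0 (a0 n) ltac:(lra)).
  by have /andP[-> ->] := bt n _ (@invDn_itv R (a n) 1 (a0 n) ltac:(lra)).
have Lmono n m : (n <= m)%N -> L n <= L m.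
  move=> /subnK <-; elim: (m - n)%N => // k IH; rewrite addSn.
  exact: le_trans IH (step _).1.
have Umono n m : (n <= m)%N -> U m <= U n.
  move=> /subnK <-; elim: (m - n)%N => // k IH; rewrite addSn.
  exact: le_trans (step _).2 IH.
have LU n m : L n <= U m.
  have [nm|/ltnW mn] := leqP n m; first exact: le_trans (Lmono _ _ nm) _.
  exact: le_trans (LUn _) (Umono _ _ mn).
exists (sup (range L)) => n.
have h1 : L n <= sup (range L).
  apply: ub_le_sup; last by exists n.
  by exists (U 0%N) => _ [m _ <-].
have h2 : sup (range L) <= U n.
  by apply: ge_sup; [exists (L 0%N); exists 0%N|move=> _ [m _ <-]].
move: h1 h2; rewrite /L /U /between.
case: (lerP (cfval (mkseq a n) 0) (cfval (mkseq a n) 1)) => _ h1 h2; [left|right].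
all: by rewrite h1 h2.
Qed.

(** A single digit equal to 1 gives only [x <= 1]; the second digit makes the tail positive and the
    bound strict. *)
Lemma cf_expands_itv (R : realType) (a : nat -> nat) (x : R) :
  (forall k, (0 < a k)%N) -> cf_expands a x -> 0 < x < 1.
Proof.
move=> a0 /(_ 2%N); rewrite /mkseq /=.
have h0 : (1 : R) <= (a 0%N)%:R by rewrite ler1n.
have h1 : (1 : R) <= (a 1%N)%:R by rewrite ler1n.
have key (y : R) : 0 <= y -> 0 < ((a 0%N)%:R + ((a 1%N)%:R + y)^-1)^-1 < 1.
  move=> y0; have p : 0 < ((a 1%N)%:R + y)^-1 by rewrite invr_gt0; lra.
  by apply/andP; split; [rewrite invr_gt0|rewrite invf_lt1]; lra.
have := key 0 (lexx _); have := key 1 ltac:(lra).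
rewrite /between; lra.
Qed.

Lemma cf_expands_shift (R : realType) (a : nat -> nat) (x : R) :
  (forall k, (0 < a k)%N) -> cf_expands a x ->
  cf_expands (fun k => a k.+1) (x^-1 - (a 0%N)%:R).
Proof.
move=> a0 xa n; have := xa n.+1; rewrite mkseqSl /=.
have a0' : all (leq 1) (mkseq (fun k => a k.+1) n) by exact: mkseq_pos.
apply: between_invD => //.
  by have /andP[] := @cfval_itv R _ 0 a0' ltac:(lra).
by have /andP[] := @cfval_itv R _ 1 a0' ltac:(lra).
Qed.

(** The remainder [x^-1 - a 0] again has a digit expansion, so it lies strictly between 0 and 1. *)
Lemma cf_expands_floor (R : realType) (a : nat -> nat) (x : R) :
  (forall k, (0 < a k)%N) -> cf_expands a x -> Num.floor x^-1 = (a 0%N)%:Z.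
Proof.
move=> a0 xa.
have /andP[h1 h2] := cf_expands_itv (fun k => a0 k.+1) (cf_expands_shift a0 xa).
by apply: floor_def; rewrite intrD -!pmulrn; apply/andP; split; lra.
Qed.

Lemma cf_expands_iter (R : realType) (a : nat -> nat) (x : R) (n : nat) :
  (forall k, (0 < a k)%N) -> cf_expands a x ->
  cf_expands (fun k => a (n + k)%N) (iter n (@gauss R) x).
Proof.
move=> a0 xa; elim: n => [|n IH]//=.
have := cf_expands_shift (fun k => a0 (n + k)%N) IH.
rewrite /gauss (cf_expands_floor (fun k => a0 (n + k)%N) IH) -pmulrn.
by congr cf_expands; apply/funext => k; rewrite addnS addSn.
Qed.

Lemma cf_expands_digit (R : realType) (a : nat -> nat) (x : R) (n : nat) :
  (forall k, (0 < a k)%N) -> cf_expands a x -> cf_digit x n.+1 = a n.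
Proof.
move=> a0 xa; rewrite /cf_digit /=.
rewrite (cf_expands_floor (fun k => a0 (n + k)%N) (cf_expands_iter n a0 xa)).
by rewrite addn0.
Qed.

(* On a quotient p / q the Gauss map is one step of the Euclidean algorithm. *)
Lemma gauss_quotient (R : realType) (p q : nat) :
  (0 < p)%N -> gauss (p%:R / q%:R : R) = (q %% p)%N%:R / p%:R.
Proof.
move=> p0; rewrite /gauss invf_div.
have p0' : (p%:R : R) != 0 by rewrite pnatr_eq0 -lt0n.
have -> : Num.floor (q%:R / p%:R : R) = (q %/ p)%N%:Z.
  apply: floor_def; rewrite intrD -!pmulrn ler_pdivlMr ?ltr0n//.
  rewrite ltr_pdivrMr ?ltr0n// natr1 -!natrM ler_nat ltr_nat.
  by rewrite leq_trunc_div ltn_ceil.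
rewrite -pmulrn {1}(divn_eq q p) natrD natrM.
by field.
Qed.

(** Infinite descent: the Gauss map sends p / q with p < q to a fraction with the smaller
    denominator p, while the orbit never reaches 0. *)
Lemma gauss_orbit_irrational (R : realType) (x : R) :
  (forall n, 0 < iter n (@gauss R) x < 1) -> Defs.irrational x.
Proof.
move=> orb [r xr].
suff H (q p : nat) (y : R) : (p < q)%N -> y = p%:R / q%:R ->
    (forall n, 0 < iter n (@gauss R) y) -> False.
  have := orb 0%N; rewrite /= xr => /andP[x0 x1].
  have r0 : 0 < r by rewrite -(ltr0q R).
  have nE : numq r = `|numq r|%N%:Z by rewrite gez0_abs// ltW// numq_gt0.
  have dE : denq r = `|denq r|%N%:Z by rewrite gez0_abs// ltW// denq_gt0.
  have xE : x = `|numq r|%N%:R / `|denq r|%N%:R.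
    by rewrite xr /ratr nE dE -!pmulrn.
  apply: (H _ _ _ _ xE) => [|n]; last by have /andP[] := orb n.
  have d0 : (0 < `|denq r|)%N by rewrite absz_gt0 denq_neq0.
  have := orb 0%N; rewrite /= xE => /andP[_].
  by rewrite ltr_pdivrMr ?ltr0n// mul1r ltr_nat.
elim/ltn_ind: q p y => q IH p y pq yE orb'.
have p0 : (0 < p)%N.
  by have := orb' 0%N; rewrite /= yE; case: (p) => //; rewrite mul0r ltxx.
apply: (IH p pq (q %% p)%N (gauss y)).
- by rewrite ltn_mod.
- by rewrite yE gauss_quotient.
- by move=> n; have := orb' n.+1; rewrite iterSr.
Qed.

Lemma cf_expands_irrational (R : realType) (a : nat -> nat) (x : R) :
  (forall k, (0 < a k)%N) -> cf_expands a x -> Defs.irrational x.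
Proof.
move=> a0 xa; apply: gauss_orbit_irrational => n.
exact: cf_expands_itv (fun k => a0 (n + k)%N) (cf_expands_iter n a0 xa).
Qed.

(** * Greedy descent against a covering mass *)

(* [k / (1 + t)] is the length of the image of [0, 1]; for a composite of
   inverse branches, [k = q_n ^- 2] and [t = q_(n-1) / q_n]. *)
Definition mobius (R : realType) (sg k t : R) (T : R -> R) : Prop :=
  forall y z : R, 0 <= y -> 0 <= z ->
    T y - T z = sg * k * (y - z) / ((1 + t * y) * (1 + t * z)).

Lemma mobius_id (R : realType) : mobius (1 : R) 1 0 id.
Proof. by move=> y z _ _ /=; field. Qed.

(** The new parameters encode the recurrence q_(n+1) = a q_n + q_(n-1); each branch reverses
    orientation, hence [- sg]. *)
Lemma mobius_branch (R : realType) (sg k t : R) (T : R -> R) (a : nat) :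
  (0 < a)%N -> 0 <= t -> mobius sg k t T ->
  mobius (- sg) (k / (a%:R + t) ^+ 2) (a%:R + t)^-1
    (fun y => T (a%:R + y)^-1).
Proof.
move=> a0 t0 TM y z y0 z0.
have a1 : (1 : R) <= a%:R by rewrite ler1n.
rewrite TM ?invr_ge0; try lra.
field; rewrite ?andbT; do ?[apply/andP; split]; apply: lt0r_neq0; lra.
Qed.

(** A lower bound, uniform in [t], for the fraction of a cylinder's length that is kept when the
    next digit is confined to [A, B). *)
Definition branch_loss (R : realType) (A B : nat) : R :=
  (B%:R - A%:R) / (A%:R * (B%:R + 1)).

Lemma branch_loss_gt0 (R : realType) (A B : nat) :
  (0 < A < B)%N -> 0 < branch_loss R A B.
Proof.
move=> /andP[A0 AB].
have A1 : (1 : R) <= A%:R by rewrite ler1n.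
have AB1 : (A%:R : R) < B%:R by rewrite ltr_nat.
by rewrite divr_gt0 ?mulr_gt0//; lra.
Qed.

Lemma mobius_len (R : realType) (sg k t : R) (T : R -> R) :
  sg * sg = 1 -> 0 <= t -> mobius sg k t T -> sg * (T 1 - T 0) = k / (1 + t).
Proof.
move=> sg2 t0 TM; rewrite TM//.
transitivity (sg * sg * (k / (1 + t))); last by rewrite sg2 mul1r.
by field; lra.
Qed.

Lemma mobius_branches_len (R : realType) (sg k t : R) (T : R -> R) (A B : nat) :
  sg * sg = 1 -> 0 < k -> 0 <= t <= 1 -> (0 < A < B)%N -> mobius sg k t T ->
  branch_loss R A B * (sg * (T 1 - T 0)) <=
  sg * (T A%:R^-1 - T B%:R^-1).
Proof.
move=> sg2 k0 t01 /andP[A0 AB] TM.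
have A1 : (1 : R) <= A%:R by rewrite ler1n.
have AB1 : (A%:R : R) < B%:R by rewrite ltr_nat.
have t0 : 0 <= t by lra.
rewrite (mobius_len sg2 t0 TM).
rewrite TM ?invr_ge0//; try lra.
set a : R := A%:R; set b : R := B%:R; rewrite -/a -/b in A1 AB1.
have -> : sg * (sg * k * (a^-1 - b^-1) / ((1 + t / a) * (1 + t / b))) =
    sg * sg * (k * (b - a) / ((a + t) * (b + t))).
  by field; rewrite ?andbT; do ?[apply/andP; split]; apply: lt0r_neq0; lra.
rewrite sg2 mul1r /branch_loss -/a -/b.
have -> : (b - a) / (a * (b + 1)) * (k / (1 + t)) =
    (k * (b - a)) / (a * (b + 1) * (1 + t)).
  by field; rewrite ?andbT; do ?[apply/andP; split]; apply: lt0r_neq0; lra.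
rewrite ler_wpM2l//; first by rewrite mulr_ge0; lra.
rewrite lef_pV2 ?posrE ?mulr_gt0//; try lra.
(* A (B + 1) (1 + t) - (A + t) (B + t) = (A - t^2) + B t (A - 1). *)
have : 0 <= b * t * (a - 1) by rewrite !mulr_ge0; lra.
have : t * t <= 1 by nra.
nra.
Qed.

(** The ratio of child to parent length is (1 + t) / ((a + t) (a + t + 1)), at most 1/2 for every
    digit and at most 2 / A^2 for digits from A on. *)
Lemma mobius_branch_len (R : realType) (sg k t gam : R) (T : R -> R) (A a : nat) :
  sg * sg = 1 -> 0 < k -> 0 <= t <= 1 -> (0 < A <= a)%N -> mobius sg k t T ->
  gam = 2^-1 \/ gam = 2 / A%:R ^+ 2 ->
  - sg * (T (a%:R + 1)^-1 - T (a%:R + 0)^-1) <= gam * (sg * (T 1 - T 0)).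
Proof.
move=> sg2 k0 t01 /andP[A0 Aa] TM gamE.
have A1 : (1 : R) <= A%:R by rewrite ler1n.
have Aa1 : (A%:R : R) <= a%:R by rewrite ler_nat.
have a0 : (0 < a)%N by exact: leq_trans Aa.
have t0 : 0 <= t by lra.
have TM' := mobius_branch a0 t0 TM.
rewrite (mobius_len _ _ TM'); last 2 first.
- by rewrite mulrNN.
- by rewrite invr_ge0; lra.
rewrite (mobius_len sg2 t0 TM).
move: A1 Aa1; set x : R := A%:R; set b : R := a%:R => A1 Aa1.
have -> : k / (b + t) ^+ 2 / (1 + (b + t)^-1) = k / ((b + t) * (b + t + 1)).
  by field; rewrite ?andbT; do ?[apply/andP; split]; apply: lt0r_neq0; lra.
rewrite mulrCA ler_wpM2l//; first lra.
rewrite -lef_pV2 ?posrE; last 2 first.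
- by case: gamE => ->; rewrite !mulr_gt0 ?invr_gt0 ?exprn_gt0; lra.
- by rewrite invr_gt0 mulr_gt0; lra.
rewrite invrK.
case: gamE => ->.
  have -> : (2^-1 / (1 + t))^-1 = 2 * (1 + t) :> R by field; lra.
  by nra.
have -> : (2 / x ^+ 2 / (1 + t))^-1 = x ^+ 2 * (1 + t) / 2 :> R.
  by field; rewrite ?andbT; do ?[apply/andP; split]; apply: lt0r_neq0; lra.
have : x ^+ 2 <= b ^+ 2 by rewrite lerXn2r ?nnegrE; lra.
nra.
Qed.

(* The children of an interval partition it, so some child does not exceed the
   average of the [h]-mass per unit of length. *)
Lemma greedy_branch (R : realType) (h T : R -> R) (A B : nat) (rho theta : R) :
  (0 < A < B)%N -> 0 <= rho -> 0 < theta ->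
  (forall y z : R, 0 <= y -> y <= z -> z <= 1 -> h y <= h z) ->
  theta * (T 1 - T 0) <= T A%:R^-1 - T B%:R^-1 ->
  h 1 - h 0 <= rho * (T 1 - T 0) ->
  exists2 a, (A <= a < B)%N &
    h a%:R^-1 - h a.+1%:R^-1 <= rho / theta * (T a%:R^-1 - T a.+1%:R^-1).
Proof.
move=> /andP[A0 AB] rho0 th0 hmono hT hrho; apply: contrapT => no.
have lt a : (A <= a < B)%N ->
    rho / theta * (T a%:R^-1 - T a.+1%:R^-1) < h a%:R^-1 - h a.+1%:R^-1.
  by move=> aAB; rewrite ltNge; apply/negP => ?; apply: no; exists a.
have tele (f : R -> R) :
    \sum_(A <= i < B) (f i%:R^-1 - f i.+1%:R^-1) = f A%:R^-1 - f B%:R^-1.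
  rewrite (telescope_big (fun i j => f i%:R^-1 - f j%:R^-1)) ?AB// => k _.
  by rewrite /= addrA subrK.
have := ltr_sum_nat AB lt.
rewrite -mulr_sumr (tele h) (tele T).
have A1 : (1 : R) <= A%:R by rewrite ler1n.
have AB1 : (A%:R : R) < B%:R by rewrite ltr_nat.
have h1 : h A%:R^-1 <= h 1.
  by apply: hmono => //; rewrite ?invr_ge0 ?invf_le1; lra.
have h0 : h 0 <= h B%:R^-1.
  by apply: hmono => //; rewrite ?invr_ge0 ?invf_le1; lra.
have : rho * (T 1 - T 0) <= rho / theta * (T A%:R^-1 - T B%:R^-1).
  by rewrite -mulrA ler_wpM2l// ler_pdivlMl.
lra.
Qed.

(** [g] is the distribution function of the sum of r_i^(s-1) times Lebesgue measure on
    [x_i - 2 r_i, x_i + 2 r_i], a window of mass 4 r_i^s. The factor 2 ensures that an interval of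
    length at most r_i containing a point within r_i of x_i lies in the window. *)
Lemma clamp_mass (R : realType) (x r : nat -> R) (s S : R) :
  (forall i, 0 < r i) -> 0 < s ->
  (forall N, \sum_(i < N) r i `^ s <= S) ->
  exists g : R -> R, [/\ forall u v, u <= v -> g u <= g v,
    g 1 - g 0 <= 4 * S &
    forall i u v, x i - 2 * r i <= u -> u <= v -> v <= x i + 2 * r i ->
      r i `^ (s - 1) * (v - u) <= g v - g u].
Proof.
move=> r0 s0 hS.
(* [cl i t] is the length of the part of window [i] to the left of [t]. *)
pose cl i t := Num.min (Num.max t (x i - 2 * r i)) (x i + 2 * r i) -
               (x i - 2 * r i).
pose F t N := \sum_(i < N) r i `^ (s - 1) * cl i t.
have cl_itv i t : 0 <= cl i t <= 4 * r i.
  have := r0 i; rewrite /cl.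
  case: (lerP t (x i - 2 * r i)) => h1;
  match goal with |- context [Num.min ?a ?b] => case: (lerP a b) => h2 end; lra.
have cl_mono i u v : u <= v -> cl i u <= cl i v.
  move=> uv; rewrite /cl lerD2r le_min ge_min ge_min lexx orbT andbT.
  by rewrite ge_max le_max le_max lexx uv orbT.
have cl_id i u : x i - 2 * r i <= u -> u <= x i + 2 * r i ->
    cl i u = u - (x i - 2 * r i).
  by move=> h1 h2; rewrite /cl (max_idPl h1) (min_idPl h2).
have F_le t N : F t N <= 4 * S.
  apply: le_trans (_ : \sum_(i < N) 4 * r i `^ s <= _); last first.
    by rewrite -mulr_sumr ler_pM2l.
  apply: ler_sum => i _.
  have -> : 4 * r i `^ s = r i `^ (s - 1) * (4 * r i).
    by rewrite -[in LHS](mulr_powRB1 (ltW (r0 i)) s0); ring.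
  rewrite ler_wpM2l ?powR_ge0//.
  by have /andP[] := cl_itv i t.
have F_mono u v N : u <= v -> F u N <= F v N.
  move=> uv; apply: ler_sum => i _.
  by rewrite ler_wpM2l ?powR_ge0 ?cl_mono.
have F_nd t N M : (N <= M)%N -> F t N <= F t M.
  move=> /subnK <-; elim: (M - N)%N => // k IH; rewrite addSn.
  apply: le_trans IH _; rewrite /F big_ord_recr /= lerDl mulr_ge0 ?powR_ge0//.
  by have /andP[] := cl_itv (k + N)%N t.
pose g t := sup (range (F t)).
have F_g t N : F t N <= g t.
  apply: ub_le_sup; last by exists N.
  by exists (4 * S) => _ [M _ <-]; exact: F_le.
have g_le t b : (forall N, F t N <= b) -> g t <= b.
  by move=> h; apply: ge_sup; [exists (F t 0%N); exists 0%N|move=> _ [N _ <-]].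
exists g; split.
- by move=> u v uv; apply: g_le => N; exact: le_trans (F_mono _ _ _ uv) (F_g _ _).
- have : 0 <= g 0 by apply: le_trans (F_g 0 0%N); rewrite /F big_ord0.
  have : g 1 <= 4 * S by apply: g_le => N; exact: F_le.
  by lra.
- move=> i u v h1 uv h2.
  set c := _ `^ _ * _; suff : g u <= g v - c by lra.
  apply: g_le => N; rewrite lerBrDr.
  (* Truncating at [N + i.+1] makes the term [i] present; it alone gains [c], and the others are
     monotone. *)
  apply: le_trans (F_g v (N + i.+1)%N).
  apply: le_trans (_ : F u (N + i.+1)%N + c <= _).
    by rewrite lerD2r F_nd ?leq_addr.
  have iN : (i < N + i.+1)%N by rewrite ltn_addl.
  rewrite /F (bigD1 (Ordinal iN))//= [leRHS](bigD1 (Ordinal iN))//=.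
  rewrite addrAC lerD//.
    rewrite /c -mulrDr ler_wpM2l ?powR_ge0// !cl_id//; lra.
  by apply: ler_sum => j _; rewrite ler_wpM2l ?powR_ge0 ?cl_mono.
Qed.

Lemma mobius_mono (R : realType) (sg k t : R) (T : R -> R) (y z : R) :
  sg * sg = 1 -> 0 < k -> 0 <= t -> mobius sg k t T ->
  0 <= y -> y <= z -> sg * T y <= sg * T z.
Proof.
move=> sg2 k0 t0 TM y0 yz; have z0 := le_trans y0 yz.
rewrite -subr_ge0 -mulrBr TM// !mulrA sg2 mul1r.
have ty : 0 <= t * y by rewrite mulr_ge0.
have tz : 0 <= t * z by rewrite mulr_ge0.
by rewrite divr_ge0 ?mulr_ge0//; lra.
Qed.

Lemma sign_mono (R : realType) (sg : R) (g : R -> R) (u v : R) :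
  sg * sg = 1 -> (forall u v, u <= v -> g u <= g v) ->
  sg * u <= sg * v -> sg * g u <= sg * g v.
Proof.
move=> sg2 gm; have /orP[/eqP->|/eqP->] : (sg == 1) || (sg == -1).
  by rewrite -sqrf_eq1 expr2 sg2.
- by rewrite !mul1r; exact: gm.
- by rewrite !mulN1r !lerN2; exact: gm.
Qed.
(** A lower bound for the fraction of length surviving the restriction of the first [n] digits. *)
Definition gap_mass (R : realType) (A B : nat -> nat) (n : nat) : R :=
  \prod_(k < n) branch_loss R (A k) (B k).

(* The invariant of the greedy descent: on the cylinder of [w], the [g]-mass
   per unit of length has grown at most by the factors lost so far. *)
Definition greedy_state (R : realType) (A B : nat -> nat) (gam : nat -> R)
    (rho : R) (g : R -> R) (w : seq nat) : Prop :=
  let sg : R := (-1) ^+ size w in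
  let T := cfval w in
  [/\ all (leq 1) w,
      exists k t, [/\ 0 < k, 0 <= t <= 1 & mobius sg k t T],
      sg * (g (T 1) - g (T 0)) <=
        rho / gap_mass R A B (size w) * (sg * (T 1 - T 0)) &
      sg * (T 1 - T 0) <= \prod_(k < size w) gam k].

Lemma gap_mass_gt0 (R : realType) (A B : nat -> nat) (n : nat) :
  (forall n, (0 < A n < B n)%N) -> 0 < gap_mass R A B n.
Proof. by move=> AB; apply: prodr_gt0 => k _; exact: branch_loss_gt0. Qed.

Lemma greedy_state_step (R : realType) (A B : nat -> nat) (gam : nat -> R)
    (rho : R) (g : R -> R) (w : seq nat) :
  (forall n, (0 < A n < B n)%N) ->
  (forall n, gam n = 2^-1 \/ gam n = 2 / (A n)%:R ^+ 2) ->
  0 <= rho -> (forall u v, u <= v -> g u <= g v) ->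
  greedy_state A B gam rho g w ->
  exists2 a, (A (size w) <= a < B (size w))%N &
    greedy_state A B gam rho g (rcons w a).
Proof.
move=> AB gamE rho0 gm [w0 [k [t [k0 t01 TM]]] hg hl].
set n := size w in hg hl *.
set sg : R := (-1) ^+ n in TM hg hl.
have sg2 : sg * sg = 1 by rewrite /sg -expr2 sqrr_sign.
have t0 : 0 <= t by lra.
have rho0' : 0 <= rho / gap_mass R A B n.
  by rewrite divr_ge0// ltW// gap_mass_gt0.
(* The factor [sg] makes both functions nondecreasing, whatever the orientation of the cylinder. *)
have [|||a aAB ha] := @greedy_branch R (fun y => sg * g (cfval w y))
    (fun y => sg * cfval w y) (A n) (B n) (rho / gap_mass R A B n)
    (branch_loss R (A n) (B n)) (AB n) rho0' (branch_loss_gt0 R (AB n)).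
- move=> y z y0 yz z1; apply: sign_mono => //.
  exact: mobius_mono TM _ _.
- by rewrite -!mulrBr; exact: mobius_branches_len TM.
- by rewrite -!mulrBr.
exists a => //.
have Aa : (0 < A n <= a)%N by have /andP[-> _] := AB n; have /andP[] := aAB.
have a0 : (0 < a)%N by case/andP: Aa => /leq_trans; apply.
split; rewrite ?size_rcons ?all_rcons ?w0 ?a0//.
- exists (k / (a%:R + t) ^+ 2), (a%:R + t)^-1; split.
  + by rewrite divr_gt0// exprn_gt0// ltr_pwDl// ltr0n.
  + exact: invDn_itv.
  + rewrite exprS mulN1r => y z y0 z0; rewrite !cfval_rcons.
    by have := mobius_branch a0 t0 TM => /(_ y z y0 z0).
- rewrite exprS mulN1r !cfval_rcons -/n -/sg addr0 /gap_mass big_ord_recr /=.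
  rewrite -/(gap_mass R A B n) invfM mulrA natr1.
  move: ha; rewrite -!mulrBr; lra.
- rewrite exprS mulN1r !cfval_rcons -/n -/sg big_ord_recr /= [leRHS]mulrC.
  apply: le_trans (mobius_branch_len sg2 k0 t01 Aa TM (gamE n)) _.
  rewrite ler_wpM2l//.
  by case: (gamE n) => ->; rewrite ?divr_ge0 ?exprn_ge0.
Qed.

Lemma greedy_path (R : realType) (A B : nat -> nat) (gam : nat -> R)
    (rho : R) (g : R -> R) :
  (forall n, (0 < A n < B n)%N) ->
  (forall n, gam n = 2^-1 \/ gam n = 2 / (A n)%:R ^+ 2) ->
  0 <= rho -> (forall u v, u <= v -> g u <= g v) -> g 1 - g 0 <= rho ->
  exists2 a : nat -> nat, forall n, (A n <= a n < B n)%N &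
    forall n, greedy_state A B gam rho g (mkseq a n).
Proof.
move=> AB gamE rho0 gm g01.
(* Dependent choice over the words satisfying the invariant assembles the finite choices into one
   digit sequence. *)
pose X := {w : seq nat | greedy_state A B gam rho g w}.
have step (x : X) : {y : X | exists2 a,
    (A (size (sval x)) <= a < B (size (sval x)))%N & sval y = rcons (sval x) a}.
  apply: cid; case: x => w wS /=.
  have [a aAB aS] := greedy_state_step AB gamE rho0 gm wS.
  by exists (exist _ _ aS), a.
have S0 : greedy_state A B gam rho g [::].
  split=> //.
  - by exists 1, 0; split; rewrite ?lexx ?ler01//; exact: mobius_id.
  - by rewrite /gap_mass /= big_ord0 expr0 !mul1r divr1 subr0 mulr1.
  - by rewrite /= big_ord0 expr0 mul1r subr0.
have [f [f0 fS]] := dependent_choice step (exist _ _ S0).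
have sz n : size (sval (f n)) = n.
  elim: n => [|n IH]; first by rewrite f0.
  by have [a _ ->] := fS n; rewrite size_rcons IH.
pose a n := last 0%N (sval (f n.+1)).
have fa n : sval (f n) = mkseq a n.
  elim: n => [|n IH]; first by rewrite f0.
  by rewrite mkseqSr -IH /a; have [b _ ->] := fS n; rewrite last_rcons.
exists a => n; last by rewrite -fa; exact: (svalP (f n)).
by have [b + E] := fS n; rewrite sz /a E last_rcons.
Qed.

Lemma half_pow_small (R : realType) (r : R) : 0 < r -> exists n, 2^-1 ^+ n <= r.
Proof.
move=> r0; exists (Num.truncn r^-1).+1.
rewrite exprVn -[leRHS]invrK lef_pV2 ?posrE ?exprn_gt0 ?invr_gt0//.
apply: le_trans (_ : (Num.truncn r^-1).+1%:R <= _).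
  by rewrite ltW// truncnS_gt// invr_ge0 ltW.
by rewrite -natrX ler_nat ltnW// ltn_expl.
Qed.

(** Suppose [y] is within r_i of x_i, and let [m.+1] be the first depth at which its cylinder has
    length at most r_i. That cylinder lies in window i, so the greedy invariant gives r_i^(s-1) <= 4
    S / gap_mass. At depth [m] the length still exceeds r_i, so r_i^(1-s) <= C gap_mass. The product
    of the two gives 1 <= 4 S C. *)
Lemma mass_escape (R : realType) (A B : nat -> nat) (gam : nat -> R)
    (s C S : R) (x r : nat -> R) :
  (forall n, (0 < A n < B n)%N) ->
  (forall n, gam n = 2^-1 \/ gam n = 2 / (A n)%:R ^+ 2) ->
  (forall n, gam n <= 2^-1) -> 0 < s < 1 -> 0 <= C ->
  (forall m, (\prod_(k < m) gam k) `^ (1 - s) <= C * gap_mass R A B m.+1) ->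
  (forall i, 0 < r i < 1) -> (forall N, \sum_(i < N) r i `^ s <= S) ->
  4 * S * C < 1 ->
  exists2 a : nat -> nat, forall n, (A n <= a n < B n)%N &
    forall y, cf_expands a y -> forall i, r i < `|y - x i|.
Proof.
move=> AB gamE gam2 s01 C0 hC r01 hS SC.
have S0 : 0 <= S by have := hS 0%N; rewrite big_ord0.
have r0 i : 0 < r i by have /andP[] := r01 i.
have [g [gm g01 gloc]] := @clamp_mass R x r s S r0 ltac:(lra) hS.
have [a aAB aS] := greedy_path AB gamE (mulr_ge0 (ler0n R 4) S0) gm g01.
have a0 k : (0 < a k)%N.
  have /andP[h _] := AB k; have /andP[h' _] := aAB k; exact: leq_trans h'.
have gam0 n : 0 < gam n.
  case: (gamE n) => ->; first by rewrite invr_gt0.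
  by rewrite divr_gt0 ?exprn_gt0 ?ltr0n//; have /andP[] := AB n.
exists a => // y ya i; rewrite ltNge; apply/negP => yx.
pose len n := (-1) ^+ n * (cfval (mkseq a n) 1 - cfval (mkseq a n) 0) : R.
have len_gt0 n : 0 < len n.
  have [_ [k [t [k0 t01 TM]]] _ _] := aS n; rewrite size_mkseq in TM.
  rewrite /len (mobius_len _ _ TM) ?divr_gt0 -?expr2 ?sqrr_sign//; lra.
have len_le n : len n <= \prod_(k < n) gam k.
  by have [_ _ _] := aS n; rewrite size_mkseq.
have prod_le n : \prod_(k < n) gam k <= 2^-1 ^+ n.
  elim: n => [|n IH]; first by rewrite big_ord0.
  by rewrite big_ord_recr exprSr ler_pM// ?prodr_ge0// => *; exact: ltW.
have ex : exists n, len n <= r i.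
  have [n hn] := half_pow_small (r0 i); exists n.
  exact: le_trans (len_le n) (le_trans (prod_le n) hn).
(* The first such depth is positive, since the empty word has length 1 and [r i < 1]. *)
case: (ex_minnP ex) => -[|m] hm mmin.
  by move: hm; rewrite /len expr0 mul1r /= subr0; have := r01 i; lra.
have rm : r i < len m.
  by rewrite ltNge; apply/negP => /mmin; rewrite ltnn.
set n := m.+1 in hm.
have dist : r i `^ (s - 1) * len n <=
    (-1) ^+ n * (g (cfval (mkseq a n) 1) - g (cfval (mkseq a n) 0)).
  have := ya n; move: hm (len_gt0 n); rewrite /len.
  move: (cfval (mkseq a n) 0) (cfval (mkseq a n) 1) => u v.
  move: yx; rewrite ler_norml => yx.
  have [E|E] : (-1) ^+ n = 1 :> R \/ (-1) ^+ n = -1 :> R.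
    by rewrite -signr_odd; case: (odd n); [right; rewrite expr1|left].
  - rewrite E !mul1r => h1 h2 h3; apply: gloc; rewrite /between in h3; lra.
  - rewrite E !mulN1r !opprB => h1 h2 h3.
    apply: gloc; rewrite /between in h3; lra.
have [_ _ hg _] := aS n; rewrite size_mkseq -/(len n) in hg.
have h1 : r i `^ (s - 1) <= 4 * S / gap_mass R A B n.
  by rewrite -(ler_pM2r (len_gt0 n)); exact: le_trans dist hg.
have h2 : r i `^ (1 - s) <= C * gap_mass R A B n.
  apply: le_trans (hC m); apply: ge0_ler_powR; rewrite ?nnegrE ?(ltW (r0 i))//.
  - lra.
  - by rewrite prodr_ge0// => *; exact: ltW.
  - exact: ltW (lt_le_trans rm (len_le m)).
have h3 : r i `^ (s - 1) * r i `^ (1 - s) = 1.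
  rewrite -powRD; last by rewrite (gt_eqF (r0 i)) implybT.
  by rewrite (_ : s - 1 + (1 - s) = 0) ?powRr0//; ring.
have := ler_pM (powR_ge0 _ _) (powR_ge0 _ _) h1 h2.
have gp := gap_mass_gt0 R n AB.
rewrite h3 (_ : 4 * S / _ * _ = 4 * S * C); first lra.
by field; exact: lt0r_neq0.
Qed.

(** * Hausdorff dimension from explicit covers *)

Lemma hcost_ge0 (R : realType) (s : R) (U : set R) : (0 <= hcost s U)%E.
Proof.
rewrite /hcost; case: ifP => // _.
by case: (diam U) => [r| |]; rewrite ?lee_fin ?powR_ge0.
Qed.

Lemma diam_ge0 (R : realType) (U : set R) : (0 <= diam U)%E.
Proof. by apply: ereal_sup_ubound; left. Qed.

Lemma le_diam (R : realType) (U : set R) (x y : R) :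
  U x -> U y -> (`|x - y|%:E <= diam U)%E.
Proof. by move=> Ux Uy; apply: ereal_sup_ubound; right; exists x => //; exists y. Qed.

Lemma diam_le (R : realType) (U : set R) (d : R) : 0 <= d ->
  (forall x y, U x -> U y -> `|x - y| <= d) -> (diam U <= d%:E)%E.
Proof.
move=> d0 h; apply: ge_ereal_sup => _ [->|[x Ux [y Uy <-]]].
  by rewrite lee_fin.
by rewrite lee_fin; exact: h.
Qed.

Lemma hcost_le (R : realType) (s : R) (U : set R) (d : R) : 0 <= s ->
  (diam U <= d%:E)%E -> (hcost s U <= (d `^ s)%:E)%E.
Proof.
move=> s0 dU; rewrite /hcost; case: ifP => _; first by rewrite lee_fin powR_ge0.
have := diam_ge0 U; move: dU; case: (diam U) => [r| |]//.
rewrite !lee_fin => rd r0; apply: ge0_ler_powR; rewrite ?nnegrE//.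
exact: le_trans rd.
Qed.

Lemma hcost0 (R : realType) (s : R) : hcost s (set0 : set R) = 0%E.
Proof. by rewrite /hcost; case: asboolP. Qed.

Lemma hcost_anti (R : realType) (s t : R) (U : set R) : t <= s -> 0 < s ->
  (diam U <= 1%:E)%E -> (hcost s U <= hcost t U)%E.
Proof.
move=> ts s0 dU; rewrite /hcost; case: ifP => // _.
have := diam_ge0 U; move: dU; case: (diam U) => [r| |]//.
rewrite !lee_fin => r1; rewrite le_eqVlt => /predU1P[<-|r0].
  by rewrite powR0 ?powR_ge0 ?gt_eqF.
by rewrite ger_powR// r0.
Qed.

Lemma hcost_dist (R : realType) (s h : R) (U : set R) (x y : R) : 0 < s ->
  (hcost s U <= h%:E)%E -> U x -> U y -> `|x - y| `^ s <= h.
Proof.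
move=> s0 + Ux Uy; rewrite /hcost.
case: asboolP => [U0|_]; first by move: Ux; rewrite U0.
have := le_diam Ux Uy; have := diam_ge0 U; case: (diam U) => [r| |]//.
rewrite !lee_fin => r0 xyr; apply: le_trans.
by apply: ge0_ler_powR; rewrite ?nnegrE//; exact: ltW.
Qed.

(** Exponents just above [d] suffice; the cap [2 * d] provides an a priori upper bound on [s] for
    the construction of covers. *)
Lemma hausdorff_dim_le (R : realType) (A : set R) (d : R) : 0 < d ->
  (forall s e : R, d < s <= 2 * d -> 0 < e -> exists U : nat -> set R,
    [/\ A `<=` \bigcup_i U i, forall i, (diam (U i) <= e%:E)%E &
      (\sum_(0 <= i <oo) hcost s (U i) <= e%:E)%E]) ->
  (hausdorff_dim A <= d%:E)%E.
Proof.
move=> d0 h; apply/lee_addgt0Pr => e e0.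
pose s := d + Num.min e d.
have [m0 [m1 me]] : 0 < Num.min e d /\ Num.min e d <= d /\ Num.min e d <= e.
  by rewrite lt_min e0 d0 !ge_min !lexx orbT.
apply: (@le_trans _ _ s%:E); last by rewrite lee_fin lerD2l.
apply: ereal_inf_lbound; exists s => //; split; first by rewrite /s; lra.
have sd : d < s <= 2 * d by rewrite /s; lra.
apply/eqP; rewrite eq_le; apply/andP; split; last first.
  apply: (@le_trans _ _ (hausdorff_delta s 1 A)).
    apply: le_ereal_inf_tmp => _ [U _ <-].
    by apply: nneseries_ge0 => *; exact: hcost_ge0.
  by apply: ereal_sup_ubound; exists 1 => //=.
apply: ge_ereal_sup => _ [dl /= dl0 <-].
apply/lee_addgt0Pr => e' e'0; rewrite add0e.
have e'' : 0 < Num.min dl e' by rewrite lt_min dl0.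
have [U [AU dU sU]] := h s _ sd e''.
apply: (@le_trans _ _ (\sum_(0 <= i <oo) hcost s (U i))%E).
  apply: ereal_inf_lbound; exists U => //; split=> // i.
  by apply: le_trans (dU i) _; rewrite lee_fin ge_min lexx.
by apply: le_trans sU _; rewrite lee_fin ge_min lexx orbT.
Qed.

(** For diameters at most 1 the cost decreases with the exponent, so a bound at the midpoint of [t]
    and [d], positive even for [t = 0], passes down to [t]. *)
Lemma hausdorff_dim_ge (R : realType) (A : set R) (d : R) : 0 < d ->
  (forall s : R, 0 < s < d -> exists2 e : R, 0 < e & forall U : nat -> set R,
    A `<=` \bigcup_i U i -> (forall i, (diam (U i) <= 1%:E)%E) ->
    (e%:E <= \sum_(0 <= i <oo) hcost s (U i))%E) ->
  (d%:E <= hausdorff_dim A)%E.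
Proof.
move=> d0 h; apply: le_ereal_inf_tmp => _ [t [t0 tA] <-].
rewrite lee_fin leNgt; apply/negP => td.
have sd : 0 < (t + d) / 2 < d by lra.
have [e e0 he] := h _ sd.
have : (e%:E <= hausdorff_measure t A)%E.
  apply: (@le_trans _ _ (hausdorff_delta t 1 A)); last first.
    by apply: ereal_sup_ubound; exists 1 => //=.
  apply: le_ereal_inf_tmp => _ [U [AU dU] <-].
  apply: le_trans (he U AU dU) _.
  apply: lee_nneseries => [*|n _]; first exact: hcost_ge0.
  by apply: hcost_anti => //; lra.
by rewrite tA lee_fin leNgt e0.
Qed.

Lemma le_powR (R : realType) (p x y : R) :
  0 <= p -> 0 <= x -> x <= y -> x `^ p <= y `^ p.
Proof.
by move=> p0 x0 xy; apply: ge0_ler_powR => //; rewrite nnegrE ?(le_trans x0).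
Qed.

Lemma powRVK (R : realType) (p x : R) : 0 < p -> 0 <= x -> (x `^ p^-1) `^ p = x.
Proof. by move=> p0 x0; rewrite -powRrM mulVf ?powRr1// gt_eqF. Qed.

Lemma powR_ge1 (R : realType) (p x : R) : 0 <= p -> 1 <= x -> 1 <= x `^ p.
Proof.
by move=> p0 x1; apply: le_trans (le_powR p0 ler01 x1); rewrite powR1.
Qed.

(** A cover of cost below [e] is enlarged to intervals of positive radius; [mass_escape] then
    produces a point of [K] outside all of them. *)
Lemma mass_lower_bound (R : realType) (A B : nat -> nat) (gam : nat -> R)
    (s C : R) (K : set R) :
  (forall n, (0 < A n < B n)%N) ->
  (forall n, gam n = 2^-1 \/ gam n = 2 / (A n)%:R ^+ 2) ->
  (forall n, gam n <= 2^-1) -> 0 < s < 1 -> 0 <= C ->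
  (forall m, (\prod_(k < m) gam k) `^ (1 - s) <= C * gap_mass R A B m.+1) ->
  (forall a y, (forall n, (A n <= a n < B n)%N) -> cf_expands a y -> K y) ->
  exists2 e : R, 0 < e & forall U : nat -> set R,
    K `<=` \bigcup_i U i -> (e%:E <= \sum_(0 <= i <oo) hcost s (U i))%E.
Proof.
move=> AB gamE gam2 s01 C0 hC KA.
(* The enlarged cover has mass at most [2 * e], and 4 (2 e) C = C / (C + 1) < 1. *)
pose e : R := (8 * (C + 1))^-1.
have e0 : 0 < e by rewrite invr_gt0; lra.
have eC : 8 * (C + 1) * e = 1 by rewrite mulfV//; apply: lt0r_neq0; lra.
exists e => // U KU; rewrite leNgt; apply/negP => sumU.
have s0 : 0 < s by lra.
have part N : (\sum_(0 <= i < N) hcost s (U i) <= e%:E)%E.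
  apply: le_trans (ltW sumU); apply: nneseries_lim_ge => *; exact: hcost_ge0.
have hfin i : hcost s (U i) = (fine (hcost s (U i)))%:E.
  rewrite fineK// ge0_fin_numE ?hcost_ge0//.
  apply: le_lt_trans (ltry e); apply: le_trans (part i.+1).
  rewrite big_nat_recr//= leeDr// sume_ge0// => *; exact: hcost_ge0.
pose h i := fine (hcost s (U i)).
have h0 i : 0 <= h i by rewrite fine_ge0// hcost_ge0.
have parth N : \sum_(i < N) h i <= e.
  have := part N; rewrite big_mkord (eq_bigr (fun i : 'I_N => (h i)%:E)).
    by rewrite sumEFin lee_fin.
  by move=> i _; exact: hfin.
(* The geometric terms, of total below [e], make every radius positive and larger than all distances
   within [U i]. *)
pose r i := (h i + e * 2^-1 ^+ i.+1) `^ s^-1.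
have q0 i : 0 < e * 2^-1 ^+ i.+1 by rewrite mulr_gt0 ?exprn_gt0.
have rs i : r i `^ s = h i + e * 2^-1 ^+ i.+1.
  rewrite /r -powRrM mulVf ?gt_eqF// powRr1//.
  by have := h0 i; have := q0 i; lra.
have geo N : \sum_(i < N) (2^-1 : R) ^+ i.+1 = 1 - 2^-1 ^+ N.
  elim: N => [|N IH]; first by rewrite big_ord0 expr0 subrr.
  by rewrite big_ord_recr /= IH exprS; field.
have sumr N : \sum_(i < N) r i `^ s <= 2 * e.
  under eq_bigr do rewrite rs.
  rewrite big_split /= -mulr_sumr geo.
  have : 0 < (2^-1 : R) ^+ N by rewrite exprn_gt0.
  have := parth N; nra.
have e2 : 2 * e < 1 by nra.
have r0 i : 0 < r i by rewrite powR_gt0//; have := h0 i; have := q0 i; lra.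
have r1 i : r i < 1.
  rewrite ltNge; apply/negP => ri.
  have : 1 <= r i `^ s by apply: powR_ge1 => //; exact: ltW.
  apply/negP; rewrite -ltNge; apply: le_lt_trans e2.
  apply: le_trans (sumr i.+1); rewrite big_ord_recr /= lerDr sumr_ge0// => *.
  exact: powR_ge0.
(* The centre is some point of [U i]; the default 0 is harmless, as an empty [U i] covers
   nothing. *)
have [||a aAB ay] := @mass_escape R A B gam s C (2 * e)
    (fun i => xget 0 (U i)) r AB gamE gam2 s01 C0 hC _ sumr.
- by move=> i; rewrite r0 r1.
- by nra.
have a0 k : (0 < a k)%N.
  have /andP[p _] := AB k; have /andP[p' _] := aAB k; exact: leq_trans p'.
have [y yE] := cf_expands_exists R a0.
have [i _ yU] := KU y (KA a y aAB yE).
have := ay y yE i; apply/negP; rewrite -leNgt.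
have Ux : U i (xget 0 (U i)) by exact: (xgetPex 0 (ex_intro _ y yU)).
have hy : `|y - xget 0 (U i)| `^ s <= h i.
  by apply: (hcost_dist s0 _ yU Ux); rewrite -hfin.
rewrite leNgt; apply/negP => /(gt0_ltr_powR s0).
rewrite !nnegrE => /(_ (ltW (r0 i)) (normr_ge0 _)); rewrite rs.
by have := q0 i; lra.
Qed.

(** * Digit sequences with a prescribed number of distinct values *)

Fixpoint ticks (R : realType) (f : nat -> R) (n : nat) : nat :=
  if n is m.+1 then
    if (ticks f m).+1%:R <= f n then (ticks f m).+1 else ticks f m
  else 0%N.

(** Position [n] counts from 0, so it is the last of the first [n.+1] digits; hence the value
    [f n.+1]. *)
Definition ticking (R : realType) (f : nat -> R) (n : nat) : bool :=
  (ticks f n).+1%:R <= f n.+1.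

Lemma ticksS (R : realType) (f : nat -> R) (n : nat) :
  ticks f n.+1 = (ticking f n + ticks f n)%N.
Proof. by rewrite /ticking /=; case: ifP. Qed.

Lemma ticks_le (R : realType) (f : nat -> R) (n : nat) :
  (forall n, 0 <= f n <= f n.+1) -> (ticks f n)%:R <= f n.
Proof.
move=> fm; elim: n => [|n IH]; first by have /andP[] := fm 0%N.
rewrite /=; case: ifP => // _; apply: le_trans IH _.
by have /andP[] := fm n.
Qed.

Lemma leq_ticks (R : realType) (f : nat -> R) (n m : nat) :
  (n <= m)%N -> (ticks f n <= ticks f m)%N.
Proof.
move=> /subnK <-; elim: (m - n)%N => // k IH; rewrite addSn ticksS.
exact: leq_trans IH (leq_addl _ _).
Qed.

(** Without a tick the count is within 1 of [f]; at a tick the gap does not grow once [f] rises by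
    at most 1 per step. The constant [f n0] absorbs the earlier steps. *)
Lemma ticks_ge (R : realType) (f : nat -> R) (n0 : nat) :
  (forall n, 0 <= f n <= f n.+1) ->
  (forall n, (n0 <= n)%N -> f n.+1 <= f n + 1) ->
  forall n, f n - (1 + f n0) <= (ticks f n)%:R.
Proof.
move=> fm f1.
have fmono n m : (n <= m)%N -> f n <= f m.
  move=> /subnK <-; elim: (m - n)%N => // k IH; rewrite addSn.
  by apply: le_trans IH _; have /andP[] := fm (k + n)%N.
have f0 n : 0 <= f n by have /andP[] := fm n.
elim=> [|n IH]; first by have := fmono 0%N n0 (leq0n _); rewrite /=; lra.
have [nn0|n0n] := ltnP n n0.
  have := fmono _ _ nn0; have : (0 : R) <= (ticks f n.+1)%:R by rewrite ler0n.
  lra.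
rewrite ticksS /ticking; have := f1 n n0n.
have := f0 n0; move: IH; case: (lerP (ticks f n).+1%:R (f n.+1)) => /=.
  by rewrite add1n -natr1; lra.
by rewrite add0n -natr1; lra.
Qed.

Lemma ticks_count (R : realType) (f : nat -> R) (n : nat) :
  ticks f n = count (ticking f) (iota 0 n).
Proof.
elim: n => // n IH.
by rewrite ticksS -addn1 iotaD count_cat -IH /= addn0 addnC.
Qed.

(* Fresh digits are taken exactly at the ticks, so the number of distinct
   digits follows [f] up to the bounded number of old digits. *)
Definition fresh_digits (R : realType) (f : nat -> R) (M : nat)
    (a : nat -> nat) : Prop :=
  [/\ forall n, ticking f n -> (M < a n)%N,
      forall n, ~~ ticking f n -> (0 < a n <= M)%N &
      forall n m, ticking f n -> ticking f m -> (n < m)%N -> (a n < a m)%N].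

(** Digits at ticks are pairwise distinct, and all others lie in 1..M. *)
Lemma fresh_digits_count (R : realType) (f : nat -> R) (M : nat)
    (a : nat -> nat) (n : nat) :
  fresh_digits f M a ->
  (ticks f n <= size (undup (mkseq a n)) <= ticks f n + M)%N.
Proof.
move=> [aM a1 ainc].
pose L := [seq a k | k <- iota 0 n & ticking f k].
have sL : size L = ticks f n by rewrite size_map size_filter ticks_count.
have uL : uniq L.
  rewrite map_inj_in_uniq ?filter_uniq ?iota_uniq// => i j.
  rewrite !mem_filter => /andP[ti _] /andP[tj _] aij.
  case: (ltngtP i j) => // lt.
    by have := ainc _ _ ti tj lt; rewrite aij ltnn.
  by have := ainc _ _ tj ti lt; rewrite aij ltnn.
apply/andP; split.
  rewrite -sL; apply: uniq_leq_size => // b /mapP[k + ->].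
  rewrite mem_filter => /andP[_ kn].
  by rewrite mem_undup map_f.
rewrite -sL -[X in (_ <= _ + X)%N](size_iota 1 M) -size_cat.
apply: uniq_leq_size => [|b]; first exact: undup_uniq.
rewrite mem_undup => /mapP[k kn ->]; rewrite mem_cat.
case: (boolP (ticking f k)) => tk.
  by rewrite map_f// mem_filter tk.
by rewrite mem_iota add1n ltnS a1// orbT.
Qed.

Lemma cf_distinct_expands (R : realType) (a : nat -> nat) (y : R) (n : nat) :
  (forall k, (0 < a k)%N) -> cf_expands a y ->
  cf_distinct y n = size (undup (mkseq a n)).
Proof.
move=> a0 ya; rewrite /cf_distinct /mkseq -[1%N]addn0 iotaDl -map_comp.
by congr (size (undup _)); apply: eq_map => k /=; exact: cf_expands_digit.
Qed.

(** The number of distinct digits stays within the constant [D] of [f n], which is negligible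
    against n^beta. *)
Lemma E_set_fresh (R : realType) (beta c : R) (M n0 : nat) (a : nat -> nat)
    (y : R) :
  let f n := c * n%:R `^ beta in
  0 < beta -> (forall n, 0 <= f n <= f n.+1) ->
  (forall n, (n0 <= n)%N -> f n.+1 <= f n + 1) ->
  fresh_digits f M a -> cf_expands a y -> E_set beta c y.
Proof.
move=> f b0 fm f1 fa ya.
have a0 k : (0 < a k)%N.
  have [h1 h2 _] := fa; case: (boolP (ticking f k)) => tk.
    exact: leq_ltn_trans (h1 _ tk).
  by have /andP[] := h2 _ tk.
split; first by have := cf_expands_itv a0 ya; lra.
split; first exact: cf_expands_irrational ya.
apply/cvgrPdist_le => /= e e0.
pose D := 1 + f n0 + M%:R.
have D0 : 0 < D.
  have /andP[h _] := fm n0; have : (0 : R) <= M%:R by rewrite ler0n.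
  by rewrite /D; lra.
near=> n.
have n1 : (D / e) `^ beta^-1 <= n%:R.
  by near: n; exact: nbhs_infty_ger.
have n0' : (0 : R) < n%:R.
  by apply: lt_le_trans n1; rewrite powR_gt0// divr_gt0.
have nb : D / e <= n%:R `^ beta.
  rewrite -(powRVK b0 (ltW (divr_gt0 D0 e0))).
  by apply: le_powR n1; [exact: ltW|exact: powR_ge0].
have nb0 : 0 < n%:R `^ beta by rewrite powR_gt0.
rewrite (cf_distinct_expands _ a0 ya).
have /andP[] := fresh_digits_count n fa.
rewrite -!(ler_nat R) natrD; move: (size _)%:R => u hu1 hu2.
have t1 := ticks_le n fm; have t2 := ticks_ge fm f1 n.
have M0 : (0 : R) <= M%:R by rewrite ler0n.
have -> : c - u / n%:R `^ beta = (f n - u) / n%:R `^ beta.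
  by rewrite /f; field; exact: lt0r_neq0.
rewrite normrM normfV (gtr0_norm nb0) ler_pdivrMr//.
apply: (@le_trans _ _ D); last by rewrite mulrC -ler_pdivrMr.
by rewrite ler_norml /D; have /andP[] := fm n0; lra.
Unshelve. all: by end_near. Qed.

(** * Growth estimates and the lower bound for beta < 1 *)

Lemma powR_sublinear (R : realType) (D b d : R) : 0 < D -> 0 <= b < 1 -> 0 < d ->
  exists2 K : R, 0 <= K & forall x, 0 <= x -> D * x `^ b <= d * x + K.
Proof.
(* [x0] solves D x^b = d x: below it the constant suffices, above it the linear term. *)
move=> D0 b01 d0; pose x0 := (D / d) `^ (1 - b)^-1.
have Dd : 0 < D / d by rewrite divr_gt0.
exists (D * x0 `^ b); first by rewrite mulr_ge0 ?powR_ge0 ?ltW.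
move=> x x0'; have K0 : 0 <= D * x0 `^ b by rewrite mulr_ge0 ?powR_ge0 ?ltW.
have [xx0|x0x] := lerP x x0.
  apply: (@le_trans _ _ (D * x0 `^ b)); last by rewrite lerDr mulr_ge0// ltW.
  by rewrite ler_pM2l//; apply: le_powR => //; lra.
have xp : 0 < x by apply: le_lt_trans x0x; exact: powR_ge0.
apply: (@le_trans _ _ (d * x)); last by rewrite lerDl.
have -> : x = x `^ (1 - b) * x `^ b.
  rewrite -powRD; last by rewrite (gt_eqF xp) implybT.
  by rewrite subrK powRr1// ltW.
rewrite mulrA [X in _ * X `^ b](_ : _ = x); last first.
  rewrite -powRD; last by rewrite (gt_eqF xp) implybT.
  by rewrite subrK powRr1// ltW.
rewrite ler_wpM2r ?powR_ge0// mulrC -ler_pdivrMr//.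
have -> : D / d = x0 `^ (1 - b).
  by rewrite powRVK//; [lra|exact: ltW].
by apply: le_powR; [lra|exact: powR_ge0|exact: ltW].
Qed.

Lemma power_target_nd (R : realType) (beta c : R) :
  let f (n : nat) := c * n%:R `^ beta in
  0 < beta -> 0 < c -> forall n, 0 <= f n <= f n.+1.
Proof.
move=> f b0 c0 n; apply/andP; split.
  by rewrite mulr_ge0 ?powR_ge0// ltW.
by rewrite /f ler_pM2l//; apply: le_powR; rewrite ?ler_nat// ltW.
Qed.

(** Since (1 + 1/n)^beta <= 1 + 1/n, the increment is at most c n^(beta-1), which is at most 1 for
    large n. *)
Lemma power_target_step (R : realType) (beta c : R) :
  let f (n : nat) := c * n%:R `^ beta in
  0 < beta < 1 -> 0 < c ->
  exists n0 : nat, forall n, (n0 <= n)%N -> f n.+1 <= f n + 1.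
Proof.
move=> f b01 c0.
exists (Num.truncn (c `^ (1 - beta)^-1)).+1 => n n0n.
have cn : c `^ (1 - beta)^-1 <= n%:R.
  apply: ltW; apply: lt_le_trans (_ : (Num.truncn (c `^ (1 - beta)^-1)).+1%:R <= _).
    by rewrite truncnS_gt// powR_ge0.
  by rewrite ler_nat.
have n0 : (0 : R) < n%:R by apply: lt_le_trans cn; exact: powR_gt0.
have cn' : c <= n%:R `^ (1 - beta).
  have b1 : 0 < 1 - beta by lra.
  rewrite -(powRVK b1 (ltW c0)).
  by apply: le_powR cn; [exact: ltW|exact: powR_ge0].
have nS : n.+1%:R = n%:R * (1 + n%:R^-1) :> R.
  by rewrite mulrDr mulr1 mulfV ?natr1// lt0r_neq0.
have ni : (0 : R) <= n%:R^-1 by rewrite invr_ge0.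
have h : n.+1%:R `^ beta <= n%:R `^ beta * (1 + n%:R^-1).
  rewrite nS powRM ?addr_ge0//.
  rewrite ler_pM2l ?powR_gt0//; apply: ler1_powR; lra.
rewrite /f; apply: le_trans (_ : c * (n%:R `^ beta * (1 + n%:R^-1)) <= _).
  by rewrite ler_pM2l.
rewrite mulrDr mulr1 mulrDr lerD2l.
apply: le_trans (_ : n%:R `^ (1 - beta) * (n%:R `^ beta / n%:R) <= _).
  by rewrite ler_wpM2r// divr_ge0 ?powR_ge0.
rewrite mulrA -powRD; last by rewrite (gt_eqF n0) implybT.
by rewrite subrK powRr1 ?(ltW n0)// mulfV// gt_eqF.
Qed.

(* Each fresh digit [M + k] costs a factor about [k ^- 2]; there are only
   [O(n ^ beta)] of them, so the total cost is subexponential. *)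
Lemma ticks_ln_sublinear (R : realType) (beta c d : R) (M : nat) :
  let f n := c * n%:R `^ beta in
  0 < beta < 1 -> 0 < c -> 0 < d -> exists2 K : R, 0 <= K &
  forall n, 2 * (ticks f n)%:R * ln (M + 2 + ticks f n)%N%:R <= d * n%:R + K.
Proof.
move=> f b01 c0 d0.
(* Chosen so that beta (1 + ep) = (1 + beta) / 2 < 1; the logarithm of [u] is bounded by u^ep /
   ep. *)
pose ep := (1 - beta) / (2 * beta).
have epE : ep = (1 - beta) / (2 * beta) by [].
have ep0 : 0 < ep by rewrite divr_gt0; lra.
clearbody ep.
pose H : R := c + M%:R + 2.
have M0 : (0 : R) <= M%:R by [].
have H0 : 0 < H by rewrite /H; lra.
have hb : 0 <= (1 + beta) / 2 < 1 by lra.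
have D0 : 0 < 2 / ep * H `^ (1 + ep) by rewrite mulr_gt0 ?divr_gt0 ?powR_gt0.
have [K K0 hK] := powR_sublinear D0 hb d0.
exists K => // -[|n]; first by rewrite /= mulr0 mul0r mulr0 add0r.
apply: le_trans (hK n.+1%:R (ler0n _ _)).
have b0 : 0 < beta by lra.
have fm := power_target_nd b0 c0.
have kf := ticks_le n.+1 fm; rewrite -/f in kf.
move: (ticks f n.+1) kf => k; rewrite /f => kf.
set u : R := (M + 2 + k)%N%:R.
have uE : u = M%:R + 2 + k%:R by rewrite /u !natrD.
have k0 : (0 : R) <= k%:R by [].
have u0 : 0 < u by lra.
have n1 : 1 <= n.+1%:R `^ beta :> R.
  by apply: powR_ge1; rewrite ?ler1n//; lra.
have uH : u <= H * n.+1%:R `^ beta by rewrite uE /H; nra.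
have lnu : ln u <= u `^ ep / ep.
  rewrite ler_pdivlMr// mulrC -ln_powR; apply/ltW/ln_sublinear.
  exact: powR_gt0.
have h1 : k%:R * ln u <= u * (u `^ ep / ep).
  apply: ler_pM => //; last lra.
  by rewrite ln_ge0//; lra.
have h2 : u `^ (1 + ep) <= H `^ (1 + ep) * n.+1%:R `^ ((1 + beta) / 2).
  have -> : (1 + beta) / 2 = beta * (1 + ep).
    by rewrite epE; field; lra.
  rewrite powRrM -powRM ?powR_ge0 ?(ltW H0)//.
  by apply: le_powR; lra.
have h3 : u * u `^ ep = u `^ (1 + ep).
  rewrite powRD ?powRr1 ?(ltW u0)//; first by rewrite (gt_eqF u0) implybT.
have -> : 2 / ep * H `^ (1 + ep) * n.+1%:R `^ ((1 + beta) / 2) =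
  2 / ep * (H `^ (1 + ep) * n.+1%:R `^ ((1 + beta) / 2)) by ring.
apply: le_trans (_ : 2 / ep * u `^ (1 + ep) <= _); last first.
  by rewrite ler_pM2l// divr_gt0.
rewrite -h3 (_ : 2 / ep * (u * u `^ ep) = 2 * (u * (u `^ ep / ep))); last ring.
by rewrite -mulrA ler_pM2l.
Qed.

(** A tick allows the single digit v and keeps 1 / (v (v + 2)), at least Q^-2 because v + 2 <= Q;
    another position keeps M / (M + 2). The latter factor is charged at ticks too, for
    uniformity. *)
Lemma gap_mass_fresh_ge (R : realType) (f : nat -> R) (M : nat) (N n : nat) :
  (0 < M)%N ->
  let A k := if ticking f k then (M + ticks f k.+1)%N else 1%N in
  let B k := if ticking f k then (M + ticks f k.+1).+1 else M.+1 in
  (n <= N)%N ->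
  (M%:R / (M%:R + 2)) ^+ n * ((M + 2 + ticks f N)%N%:R ^- 2) ^+ ticks f n
    <= gap_mass R A B n.
Proof.
move=> M0 A B; set Q : R := (M + 2 + ticks f N)%N%:R.
have M1 : (1 : R) <= M%:R by rewrite ler1n.
have Q0 : 0 < Q by rewrite ltr0n addnAC addn2.
have q0 : 0 < Q ^- 2 by rewrite invr_gt0 exprn_gt0.
have th0 : 0 < M%:R / (M%:R + 2) :> R by rewrite divr_gt0//; lra.
elim: n => [|n IH] nN; first by rewrite /gap_mass big_ord0 !expr0 mulr1.
rewrite /gap_mass big_ord_recr /= -/(gap_mass R A B n).
have {}IH := IH (ltnW nN).
have p0 : 0 <= (M%:R / (M%:R + 2)) ^+ n * (Q ^- 2) ^+ ticks f n.
  by rewrite mulr_ge0 ?exprn_ge0 ?ltW.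
have tN := leq_ticks f nN.
have -> : (if (ticks f n).+1%:R <= f n.+1 then (ticks f n).+1 else ticks f n) =
  ticks f n.+1 by [].
rewrite /A /B; case: (boolP (ticking f n)) => tk.
- rewrite ticksS tk add1n in tN; rewrite ticksS tk add1n.
  have -> : (M%:R / (M%:R + 2)) ^+ n.+1 * (Q ^- 2) ^+ (ticks f n).+1 =
      (M%:R / (M%:R + 2)) ^+ n * (Q ^- 2) ^+ ticks f n *
      (M%:R / (M%:R + 2) * Q ^- 2) by rewrite !exprSr; ring.
  apply: ler_pM => //; first by rewrite mulr_ge0 ?(ltW th0) ?(ltW q0).
  set v : R := (M + (ticks f n).+1)%N%:R.
  have v1 : 1 <= v by rewrite ler1n ltn_addr.
  have vQ : v + 2 <= Q by rewrite /v /Q -natrD ler_nat; lia.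
  rewrite /branch_loss -/v (_ : (M + (ticks f n).+1).+1%:R = v + 1); last first.
    by rewrite /v natr1.
  have -> : (v + 1 - v) / (v * (v + 1 + 1)) = (v * (v + 2))^-1.
    by field; lra.
  apply: (@le_trans _ _ (1 * Q ^- 2)).
    by rewrite ler_wpM2r ?(ltW q0)// ler_pdivrMr; lra.
  rewrite mul1r lef_pV2 ?posrE ?exprn_gt0 ?mulr_gt0//; [nra|lra..].
- rewrite ticksS (negbTE tk) add0n exprSr mulrAC ler_pM ?(ltW th0)//.
  rewrite /branch_loss -[M.+1%:R]natr1 (_ : M%:R + 1 - 1 = M%:R); last ring.
  have -> : M%:R + 1 + 1 = M%:R + 2 :> R by ring.
  by rewrite mul1r.
Qed.

Lemma E_set_mass (R : realType) (beta c s : R) :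
  0 < beta < 1 -> 0 < c -> 0 < s < 1 ->
  exists2 e : R, 0 < e & forall U : nat -> set R,
    E_set beta c `<=` \bigcup_i U i ->
    (e%:E <= \sum_(0 <= i <oo) hcost s (U i))%E.
Proof.
move=> b01 c0 s01; have b0 : 0 < beta by lra.
pose f (n : nat) := c * n%:R `^ beta.
have fm := power_target_nd b0 c0.
have [n0 f1] := power_target_step b01 c0.
have ln2 : 0 < ln (2 : R) by rewrite ln_gt0// ltr1n.
(* The power 1 - s of 2^-m decays at rate [2 * d]: one [d] pays for confining old digits to 1..M,
   the other for the fresh digits. *)
pose d := (1 - s) * ln 2 / 2.
have dE : 2 * d = (1 - s) * ln 2 by rewrite /d; field.
have d0 : 0 < d by rewrite /d divr_gt0 ?mulr_gt0//; lra.
pose M := (Num.truncn (2 / d)).+1.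
have M0 : (0 < M)%N by [].
have M1 : (1 : R) <= M%:R by rewrite ler1n.
have Md : 2 / M%:R <= d.
  rewrite ler_pdivrMr; last lra.
  rewrite mulrC -ler_pdivrMr//; rewrite ltW// /M.
  by rewrite truncnS_gt.
have [K K0 hK] := ticks_ln_sublinear M b01 c0 d0; rewrite -/f in hK.
pose A k := if ticking f k then (M + ticks f k.+1)%N else 1%N.
pose B k := if ticking f k then (M + ticks f k.+1).+1 else M.+1.
have AB n : (0 < A n < B n)%N.
  by rewrite /A /B; case: ifP => _; rewrite ?addn_gt0 ?M0 ?ltnSn.
have C0 : 0 <= expR (K + 2 * d) by exact: expR_ge0.
(* In the constant, [K] comes from the sublinear estimate and [2 * d] from the shift between [m] and
   [m.+1]. *)
apply: (@mass_lower_bound R A B (fun=> 2^-1) s (expR (K + 2 * d)) _ AB _ _ s01 C0).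
- by move=> n; left.
- by [].
- move=> m; rewrite big_const_ord iter_mulr_1.
  set N := m.+1; set Q : R := (M + 2 + ticks f N)%N%:R.
  have Q0 : 0 < Q by rewrite ltr0n addnAC addn2.
  apply: (@le_trans _ _ (expR (K + 2 * d) *
      ((M%:R / (M%:R + 2)) ^+ N * (Q ^- 2) ^+ ticks f N))); last first.
    by rewrite ler_pM2l ?expR_gt0//; exact: gap_mass_fresh_ge.
  have th0 : 0 < M%:R / (M%:R + 2) :> R by rewrite divr_gt0//; lra.
  have q0 : 0 < Q ^- 2 by rewrite invr_gt0 exprn_gt0.
  rewrite -ler_ln ?posrE ?mulr_gt0 ?powR_gt0 ?exprn_gt0 ?expR_gt0//.
  rewrite !lnM ?posrE ?mulr_gt0 ?exprn_gt0 ?expR_gt0//.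
  rewrite ln_powR expRK !lnXn//.
  have lnQ : ln (Q ^- 2) = - (ln Q *+ 2) by rewrite lnV ?posrE ?exprn_gt0// lnXn.
  have ln12 : ln 2^-1 = - ln 2 :> R by rewrite lnV ?posrE.
  rewrite lnQ ln12.
  have lnth : - (2 / M%:R : R) <= ln (M%:R / (M%:R + 2) : R).
    have -> : M%:R / (M%:R + 2) = ((M%:R + 2) / M%:R)^-1 :> R by rewrite invf_div.
    rewrite lnV ?posrE ?divr_gt0 ?lerN2//; try lra.
    have -> : (M%:R + 2) / M%:R = 1 + 2 / M%:R :> R by field; lra.
    by apply: le_ln1Dx; apply: lt_le_trans (_ : 0 <= _); rewrite ?divr_ge0//; lra.
  have := hK N; rewrite -/Q.
  rewrite -(mulr_natr (- ln 2) m) -(mulr_natr (ln _) N).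
  rewrite -(mulr_natr (- _) (ticks f N)) -(mulr_natr (ln Q) 2).
  have NE : N%:R = m%:R + 1 :> R by rewrite natr1.
  have mn : (0 : R) <= m%:R by [].
  rewrite NE => hQ.
  have : (m%:R + 1) * ln (M%:R / (M%:R + 2)) >= - (d * (m%:R + 1)).
    by rewrite [leRHS]mulrC -mulNr ler_pM2r; lra.
  have : (1 - s) * (m%:R * ln 2) = 2 * d * m%:R by rewrite dE; ring.
  lra.
- move=> a y aAB ya; apply: (@E_set_fresh R beta c M n0 a y b0 fm f1 _ ya).
  split.
  + move=> n tn; have := aAB n; rewrite /A tn => /andP[h _].
    by apply: leq_trans h; rewrite ticksS tn addnA addn1 ltnS leq_addr.
  + move=> n tn; have := aAB n; rewrite /A /B (negbTE tn) ltnS; done.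
  + move=> n k tn tk nk; have := aAB n; have := aAB k; rewrite /A /B tn tk.
    move=> /andP[h _] /andP[_ h']; apply: leq_trans h' (leq_trans _ h).
    rewrite ltn_add2l [in X in (_ < X)%N]ticksS tk add1n ltnS.
    exact: leq_ticks.
Qed.

(** * The lower bound for beta = 1 *)

(* The sum of the (1-based) tick times before [n], i.e. the base-2 logarithm,
   up to [O(n)], of the product of the large digits. *)
Definition tick_sum (R : realType) (f : nat -> R) (n : nat) : nat :=
  (\sum_(k < n | ticking f k) k.+1)%N.

Lemma tick_sumS (R : realType) (f : nat -> R) (n : nat) :
  tick_sum f n.+1 = (tick_sum f n + (if ticking f n then n.+1 else 0))%N.
Proof.
by rewrite /tick_sum big_mkcond big_ord_recr /= -big_mkcond.
Qed.

(** At most [T] ticks come before time [T], and each later one weighs at least [T]. As [T] is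
    arbitrary, [tick_sum] outgrows every linear term when ticks have positive density. *)
Lemma tick_sum_ge (R : realType) (f : nat -> R) (T n : nat) :
  (T * ticks f n <= tick_sum f n + T * T)%N.
Proof.
elim: n => [|n IH]; first by rewrite /= muln0.
have tn : (ticks f n <= n)%N.
  by rewrite ticks_count -{2}(size_iota 0 n) count_size.
rewrite tick_sumS ticksS; case: ifP => _; last by rewrite addn0.
rewrite add1n; have [Tn|nT] := leqP T n.+1; first nia.
apply: leq_trans (_ : T * T <= _)%N; last by rewrite leq_addl.
by rewrite leq_mul2l; apply/orP; right; lia.
Qed.

Lemma pow2_prod_le (R : realType) (f : nat -> R) (n : nat) :
  \prod_(k < n) (if ticking f k then 2 / (2 ^ k.+1)%N%:R ^+ 2 else 2^-1) <=
  2 ^+ n / 4 ^+ tick_sum f n :> R.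
Proof.
elim: n => [|n IH]; first by rewrite /tick_sum !big_ord0 !expr0 divr1.
have prod0 : 0 <= \prod_(k < n)
    (if ticking f k then 2 / (2 ^ k.+1)%N%:R ^+ 2 else 2^-1 : R).
  by apply: prodr_ge0 => k _; case: ifP; rewrite ?divr_ge0 ?exprn_ge0.
rewrite big_ord_recr /= tick_sumS.
have -> : 2 ^+ n.+1 / 4 ^+ (tick_sum f n + (if ticking f n then n.+1 else 0)) =
    2 ^+ n / 4 ^+ tick_sum f n * (2 / 4 ^+ (if ticking f n then n.+1 else 0)) :> R.
  rewrite exprD exprSr; field.
  by rewrite !expf_neq0 ?pnatr_eq0.
apply: ler_pM => //; first by case: ifP; rewrite ?divr_ge0 ?exprn_ge0.
case: ifP => _; last by rewrite expr0; lra.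
by rewrite natrX -exprM mulnC exprM (_ : 2 ^+ 2 = 4)//; ring.
Qed.

(** With p = 2^(k+1) a tick keeps 1 / (2 p + 1), and the lone digit 1 elsewhere keeps 1/3; the
    factor 8 covers both. *)
Lemma gap_mass_pow2_ge (R : realType) (f : nat -> R) (n : nat) :
  (8 ^+ n * 2 ^+ tick_sum f n)^-1 <=
  gap_mass R (fun k => if ticking f k then (2 ^ k.+1)%N else 1%N)
    (fun k => if ticking f k then (2 ^ k.+2)%N else 2%N) n.
Proof.
elim: n => [|n IH].
  by rewrite /gap_mass /tick_sum !big_ord0 !expr0 mulr1 invr1.
rewrite /gap_mass big_ord_recr /= -/(gap_mass R _ _ n) tick_sumS.
have -> : (8 ^+ n.+1 * 2 ^+ (tick_sum f n + (if ticking f n then n.+1 else 0)))^-1 =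
    (8 ^+ n * 2 ^+ tick_sum f n)^-1 *
    (8 * 2 ^+ (if ticking f n then n.+1 else 0))^-1 :> R.
  by rewrite -invfM exprD exprSr; congr (_^-1); ring.
apply: ler_pM; rewrite ?invr_ge0 ?mulr_ge0 ?exprn_ge0//.
rewrite /branch_loss; case: ifP => _; last first.
  have -> : (2%:R - 1%:R) / (1%:R * (2%:R + 1)) = 3^-1 :> R by field.
  by rewrite expr0 mulr1; lra.
rewrite !natrX [2 ^+ n.+2]exprS; set p : R := 2 ^+ n.+1.
have p1 : 1 <= p by rewrite exprn_ege1// ler1n.
have -> : (2 * p - p) / (p * (2 * p + 1)) = (2 * p + 1)^-1 by field; lra.
by rewrite lef_pV2 ?posrE; lra.
Qed.

(** A tick at time k divides the length by about 4^k but the mass only by about 2^k, so the power 1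
    - s of the length is dominated as soon as 2 (1 - s) > 1. *)
Lemma F_set_mass (R : realType) (c s : R) :
  0 < c <= 1 -> 0 < s < 1 / 2 ->
  exists2 e : R, 0 < e & forall U : nat -> set R,
    F_set c `<=` \bigcup_i U i ->
    (e%:E <= \sum_(0 <= i <oo) hcost s (U i))%E.
Proof.
move=> c01 s01.
pose f (n : nat) := c * n%:R `^ 1.
have c0 : 0 < c by lra.
have fE n : f n = c * n%:R by rewrite /f powRr1.
have fm := power_target_nd ltr01 c0.
have f1 n : (0 <= n)%N -> f n.+1 <= f n + 1 by rewrite !fE -natr1; lra.
have tge n : f n - (1 + f 0%N) <= (ticks f n)%:R by exact: (ticks_ge fm f1).
pose A k := if ticking f k then (2 ^ k.+1)%N else 1%N.
pose B k := if ticking f k then (2 ^ k.+2)%N else 2%N.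
have AB n : (0 < A n < B n)%N.
  by rewrite /A /B; case: ifP => _; rewrite // expn_gt0 ltn_exp2l// ltnSn.
pose gam k : R := if ticking f k then 2 / (2 ^ k.+1)%N%:R ^+ 2 else 2^-1.
pose eta := 1 - 2 * s.
have eta0 : 0 < eta by rewrite /eta; lra.
(* In base 2 the surplus [eta * tick_sum] must absorb [5 * m + 4] up to a constant; by [tick_sum_ge]
   this needs T eta c >= 5, and [K] collects the constants. *)
pose T := (Num.truncn (5 / (eta * c))).+1.
have Tge : 5 <= T%:R * (eta * c).
  rewrite -ler_pdivrMr ?mulr_gt0// ltW// /T truncnS_gt//.
pose K := 4 + eta * (T%:R * (1 + f 0%N) + T%:R * T%:R).
have K0 : 0 <= 2 `^ K :> R by exact: powR_ge0.
have s1 : 0 < s < 1 by lra.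
apply: (@mass_lower_bound R A B gam s (2 `^ K) _ AB _ _ s1 K0).
- by move=> n; rewrite /gam /A; case: ifP; [right|left].
- move=> n; rewrite /gam; case: ifP => // _.
  rewrite natrX [2 ^+ n.+1]exprS exprMn.
  have p1 : 1 <= (2 ^+ n) ^+ 2 :> R by rewrite !exprn_ege1// ler1n.
  have -> : 2 / (2 ^+ 2 * (2 ^+ n) ^+ 2) = 2^-1 / (2 ^+ n) ^+ 2 :> R.
    by field; rewrite expf_neq0 ?pnatr_eq0.
  by rewrite ler_pdivrMr; lra.
- move=> m; apply: (@le_trans _ _
    (2 `^ K * (8 ^+ m.+1 * 2 ^+ tick_sum f m.+1)^-1)); last first.
    by rewrite ler_wpM2l//; exact: gap_mass_pow2_ge.
  apply: (@le_trans _ _ ((2 ^+ m / 4 ^+ tick_sum f m) `^ (1 - s))).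
    apply: le_powR; [lra| |exact: pow2_prod_le].
    by apply: prodr_ge0 => k _; rewrite /gam; case: ifP; rewrite ?divr_ge0 ?exprn_ge0.
  have e4 : 4 = 2 ^+ 2 :> R by ring.
  have e8 : 8 = 2 ^+ 3 :> R by ring.
  rewrite e4 e8 -!exprM -exprD -!powR_mulrn// -!powRN -powRD ?pnatr_eq0 ?implybT//.
  rewrite -powRD ?pnatr_eq0 ?implybT// -powRrM.
  apply: ler_powR; first by rewrite ler1n.
  have h1 := tge m; rewrite [f m]fE in h1.
  have h2 : T%:R * (ticks f m)%:R <= (tick_sum f m)%:R + T%:R * T%:R :> R.
    by rewrite -!natrM -natrD ler_nat tick_sum_ge.
  have h3 : (tick_sum f m.+1)%:R <= (tick_sum f m)%:R + m%:R + 1 :> R.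
    rewrite -addrA natr1 -natrD ler_nat tick_sumS leq_add2l.
    by case: ifP.
  have h4 : 5 * m%:R <= T%:R * (eta * c) * m%:R by rewrite ler_wpM2r.
  have h5 : T%:R * (c * m%:R - (1 + f 0%N)) <= T%:R * (ticks f m)%:R.
    by rewrite ler_wpM2l.
  have h6 : eta * (T%:R * (c * m%:R - (1 + f 0%N))) <=
      eta * ((tick_sum f m)%:R + T%:R * T%:R).
    by rewrite ler_pM2l//; exact: le_trans h2.
  have h7 : 5 * m%:R + 4 <= K + eta * (tick_sum f m)%:R.
    have -> : K + eta * (tick_sum f m)%:R =
      4 + eta * (T%:R * (1 + f 0%N)) + eta * ((tick_sum f m)%:R + T%:R * T%:R).
      by rewrite /K; ring.
    apply: le_trans (_ : 4 + eta * (T%:R * (1 + f 0%N)) +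
      eta * (T%:R * (c * m%:R - (1 + f 0%N))) <= _); last by rewrite lerD2l.
    rewrite (_ : 4 + _ + _ = 4 + T%:R * (eta * c) * m%:R); first lra.
    by ring.
  rewrite !natrM !natrD !natrM -[m.+1%:R]natr1.
  have m0 : (0 : R) <= m%:R by [].
  have h8 : s * m%:R >= 0 by rewrite mulr_ge0//; lra.
  have -> : (m%:R - 2 * (tick_sum f m)%:R) * (1 - s) = m%:R - s * m%:R
     - (tick_sum f m)%:R - eta * (tick_sum f m)%:R by rewrite /eta; ring.
  lra.
- move=> a y aAB ya; apply: (@E_set_fresh R 1 c 1 0 a y ltr01 fm f1 _ ya).
  split.
  + move=> n tn; have := aAB n; rewrite /A tn => /andP[h _].
    apply: leq_trans h; rewrite -[X in (X <= _)%N](expn1 2).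
    by rewrite leq_exp2l.
  + by move=> n tn; have := aAB n; rewrite /A /B (negbTE tn) ltnS.
  + move=> n k tn tk nk; have := aAB n; have := aAB k; rewrite /A /B tn tk.
    move=> /andP[h _] /andP[_ h']; apply: leq_trans h' (leq_trans _ h).
    by rewrite leq_exp2l.
Qed.

(** * Upper bounds *)

Lemma hcost_series_le (R : realType) (s b : R) (U : nat -> set R) (v : nat -> R) :
  (forall i, (hcost s (U i) <= (v i)%:E)%E) ->
  (forall N, \sum_(i < N) v i <= b) ->
  (\sum_(0 <= i <oo) hcost s (U i) <= b%:E)%E.
Proof.
move=> Uv vb; apply: lime_le.
  by apply: is_cvg_nneseries => *; exact: hcost_ge0.
apply: nearW => N; rewrite big_mkord.
apply: (@le_trans _ _ (\sum_(i < N) (v i)%:E)%E).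
  by apply: lee_sum => i _; exact: Uv.
by rewrite sumEFin lee_fin.
Qed.

Lemma natr_ge (R : realType) (x : R) : exists n : nat, x <= n.+1%:R.
Proof.
have [x0|x0] := lerP 0 x; last by exists 0%N; apply: ltW; lra.
by exists (Num.truncn x); rewrite ltW// truncnS_gt.
Qed.

Lemma hausdorff_dim_unit (R : realType) (A : set R) :
  (forall x, A x -> 0 <= x < 1) -> (hausdorff_dim A <= 1%:E)%E.
Proof.
move=> A01; apply: hausdorff_dim_le => // s e s12 e0.
have s1 : 0 < s - 1 by lra.
(* N intervals of length 1/N: the first bound makes the diameters at most [e], the second makes the
   total cost N^(1-s) at most [e]. *)
have [n hn] := natr_ge (Num.max e^-1 (e^-1 `^ (s - 1)^-1)).
move: hn; set N := n.+1; rewrite ge_max => /andP[Ne Ns].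
have N0 : (0 : R) < N%:R by [].
have ei : 0 <= e^-1 by rewrite invr_ge0 ltW.
have Ne' : N%:R^-1 <= e by rewrite -[leRHS]invrK lef_pV2 ?posrE ?invr_gt0.
pose U i := if (i < N)%N then [set x : R | i%:R / N%:R <= x <= i.+1%:R / N%:R]
            else set0.
have dU i : (diam (U i) <= (N%:R^-1)%:E)%E.
  apply: diam_le; first by rewrite invr_ge0.
  rewrite /U; case: ifP => // _ x y /= hx hy.
  have E : i.+1%:R / N%:R = i%:R / N%:R + N%:R^-1 :> R.
    by rewrite -natr1 mulrDl mul1r.
  by rewrite ler_norml; lra.
exists U; split.
- move=> x /A01 /andP[x0 x1]; exists (Num.truncn (x * N%:R)) => //.
  have xN : 0 <= x * N%:R by rewrite mulr_ge0.
  have /andP[h1 h2] := truncn_itv xN.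
  have tN : (Num.truncn (x * N%:R) < N)%N.
    rewrite -(ltr_nat R); apply: le_lt_trans h1 _.
    by rewrite -[ltRHS]mul1r ltr_pM2r.
  rewrite /U tN /=; apply/andP; split; first by rewrite ler_pdivrMr.
  by rewrite ler_pdivlMr// ltW.
- by move=> i; apply: le_trans (dU i) _; rewrite lee_fin.
- pose v i : R := if (i < N)%N then N%:R^-1 `^ s else 0.
  apply: (@hcost_series_le _ _ _ _ v) => [i|K].
    rewrite /v; case: ifP => iN; first by apply: hcost_le => //; lra.
    by rewrite /U iN hcost0.
  have p0 : 0 <= N%:R^-1 `^ s :> R by exact: powR_ge0.
  have : \sum_(i < K) v i <= (minn K N)%:R * N%:R^-1 `^ s.
    elim: K => [|K IH]; first by rewrite big_ord0 mulr_ge0.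
    rewrite big_ord_recr /=; apply: le_trans (lerD IH (lexx _)) _.
    rewrite /v; case: (boolP (K < N)%N) => KN.
      have -> : minn K.+1 N = (minn K N).+1 by lia.
      by rewrite -[(minn K N).+1%:R]natr1 mulrDl mul1r.
    rewrite addr0 ler_wpM2r// ler_nat; lia.
  move/le_trans; apply.
  apply: (@le_trans _ _ (N%:R * N%:R^-1 `^ s)).
    by rewrite ler_wpM2r// ler_nat; lia.
  have -> : N%:R^-1 `^ s = N%:R^-1 * N%:R^-1 `^ (s - 1) :> R.
    by rewrite mulr_powRB1 ?invr_ge0//; lra.
  rewrite mulrA mulfV ?gt_eqF// mul1r -(powRVK s1 (ltW e0)).
  apply: le_powR; rewrite ?invr_ge0//; first lra.
  rewrite -[leRHS]invrK lef_pV2 ?posrE ?invr_gt0 ?powR_gt0//.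
  apply: le_trans Ns; rewrite -powRN.
  by rewrite -[e^-1]powR_inv1 ?(ltW e0)// -!powRrM mulN1r.
Qed.

(** * Digits and cylinders of an irrational number *)

Lemma irrational_gauss (R : realType) (x : R) :
  Defs.irrational x -> Defs.irrational (gauss x).
Proof.
move=> xi [q gq]; apply: xi; exists (q + (Num.floor x^-1)%:~R)^-1.
rewrite fmorphV rmorphD /= ratr_int -gq /gauss.
by rewrite subrK invrK.
Qed.

Lemma gauss_itv (R : realType) (x : R) : 0 <= gauss x < 1.
Proof.
by have := floor_itv x^-1; rewrite /gauss intrD; lra.
Qed.

Lemma gauss_iter_itv (R : realType) (x : R) (n : nat) :
  Defs.irrational x -> 0 <= x < 1 ->
  Defs.irrational (iter n (@gauss R) x) /\ 0 <= iter n (@gauss R) x < 1.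
Proof.
move=> xi x01; elim: n => //= n [IH _]; split; last exact: gauss_itv.
exact: irrational_gauss.
Qed.

(** Irrationality keeps the orbit away from 0, so no inverse of 0 occurs and every floor is at least
    1. *)
Lemma cf_digit_gauss (R : realType) (x : R) (n : nat) :
  Defs.irrational x -> 0 <= x < 1 -> (0 < cf_digit x n.+1)%N /\
  iter n (@gauss R) x =
    ((cf_digit x n.+1)%:R + iter n.+1 (@gauss R) x)^-1.
Proof.
move=> xi x01; have [zi z01] := gauss_iter_itv n xi x01.
rewrite /cf_digit /=; move: (iter n _ x) zi z01 => z zi /andP[z0 z1].
have {}z0 : 0 < z.
  by rewrite lt_neqAle z0 andbT; apply/eqP => zE; apply: zi; exists 0; rewrite raddf0.
have f1 : 1 <= Num.floor z^-1.
  by rewrite floor_ge_int invf_ge1// ltW.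
have fE : Num.floor z^-1 = `|Num.floor z^-1|%N%:Z by rewrite gez0_abs//; lia.
split; first by rewrite absz_gt0; apply/eqP; lia.
rewrite /gauss {2}fE -pmulrn addrC subrK invrK//.
Qed.

(** Digits are numbered from 1 in [cf_digit] and from 0 in [mkseq]. *)
Definition cf_seq (R : realType) (x : R) (k : nat) : nat := cf_digit x k.+1.

Lemma cfval_cf_seq (R : realType) (x : R) (n : nat) :
  Defs.irrational x -> 0 <= x < 1 ->
  x = cfval (mkseq (cf_seq x) n) (iter n (@gauss R) x).
Proof.
move=> xi x01; elim: n => // n IH.
by rewrite mkseqSr cfval_rcons {2}/cf_seq -(cf_digit_gauss n xi x01).2.
Qed.

Definition cylinder (R : realType) (w : seq nat) : set R :=
  [set cfval w y | y in [set y | 0 <= y <= 1]].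

(** On nonnegative tails the branch of digit b contracts by at least b^-2. *)
Lemma cfval_contract (R : realType) (w : seq nat) (y z : R) :
  all (leq 1) w -> 0 <= y <= 1 -> 0 <= z <= 1 ->
  `|cfval w y - cfval w z| <= \prod_(b <- w) b%:R ^- 2.
Proof.
elim: w => [_ y01 z01|b w IH /= /andP[b0 w0] y01 z01].
  by rewrite big_nil ler_norml /=; lra.
rewrite big_cons.
have b1 : (1 : R) <= b%:R by rewrite ler1n.
have /andP[u0 _] := cfval_itv w0 y01; have /andP[v0 _] := cfval_itv w0 z01.
have := IH w0 y01 z01; move: (cfval w y) (cfval w z) u0 v0 => u v u0 v0 uv.
have -> : (b%:R + u)^-1 - (b%:R + v)^-1 =
    ((b%:R + u) * (b%:R + v))^-1 * (v - u).
  by field; rewrite ?andbT; do ?[apply/andP; split]; apply: lt0r_neq0; lra.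
rewrite normrM distrC; apply: ler_pM => //.
rewrite ger0_norm ?invr_ge0 ?mulr_ge0 ?addr_ge0//.
rewrite lef_pV2 ?posrE ?mulr_gt0 ?exprn_gt0//; [nra|lra..].
Qed.

Lemma diam_cylinder (R : realType) (w : seq nat) : all (leq 1) w ->
  (diam (@cylinder R w) <= (\prod_(b <- w) b%:R ^- 2)%:E)%E.
Proof.
move=> w0; apply: diam_le.
  by apply: prodr_ge0 => b _; rewrite invr_ge0 exprn_ge0.
by move=> _ _ [y y01 <-] [z z01 <-]; exact: cfval_contract.
Qed.

(** The right-hand side is the integral of u^(-1-eta) over [x - 1, x]. The bound reduces to (1 -
    1/x)^(-eta) >= 1 + eta / x, which follows from e^u >= 1 + u and ln (1 + u) <= u. *)
Lemma powRN1_telescope (R : realType) (eta x : R) : 0 < eta -> 1 < x ->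
  x `^ (- (1 + eta)) <= ((x - 1) `^ (- eta) - x `^ (- eta)) / eta.
Proof.
move=> e0 x1; have x0 : 0 < x by lra.
rewrite ler_pdivlMr//.
have -> : x `^ (- (1 + eta)) = x `^ (- eta) * x^-1.
  rewrite opprD addrC powRD; last by rewrite (gt_eqF x0) implybT.
  by rewrite powR_inv1 ?ltW.
have xi : 0 < x^-1 < 1 by rewrite invr_gt0 x0 invf_lt1.
have y0 : 0 < 1 - x^-1 by lra.
have -> : x - 1 = x * (1 - x^-1) by field; lra.
rewrite powRM ?(ltW x0) ?(ltW y0)//.
have h : 1 + eta * x^-1 <= (1 - x^-1) `^ (- eta).
  rewrite /powR (gt_eqF y0); apply: le_trans (expR_ge1Dx _).
  rewrite lerD2l mulNr -mulrN ler_pM2l// lerNr.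
  by apply: le_ln1Dx; lra.
have p0 : 0 <= x `^ (- eta) by exact: powR_ge0.
have := ler_wpM2l p0 h; lra.
Qed.

Lemma powR_tail_le (R : realType) (eta : R) (m n : nat) : 0 < eta -> (0 < m)%N ->
  \sum_(m <= k < m + n) k.+1%:R `^ (- (1 + eta)) <= m%:R `^ (- eta) / eta.
Proof.
move=> e0 m0.
apply: (@le_trans _ _ ((m%:R `^ (- eta) - (m + n)%N%:R `^ (- eta)) / eta)).
  elim: n => [|n IH]; first by rewrite addn0 big_geq// subrr mul0r.
  rewrite addnS big_nat_recr ?leq_addr//=.
  have x1 : 1 < (m + n).+1%:R :> R by rewrite ltr1n ltnS addn_gt0 m0.
  apply: le_trans (lerD IH (powRN1_telescope e0 x1)) _.
  rewrite -natr1 addrK; lra.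
by rewrite ler_wpM2r ?invr_ge0 ?(ltW e0)// lerBlDr lerDl powR_ge0.
Qed.

(** * Weighted counting of words *)

Fixpoint words (L n : nat) : seq (seq nat) :=
  if n is m.+1 then [seq b :: w | b <- iota 1 L, w <- words L m]
  else [:: [::]].

Lemma mem_words (L : nat) (w : seq nat) :
  all (leq 1) w -> all (geq L) w -> w \in words L (size w).
Proof.
elim: w => [|b w IH] //= /andP[b0 w0] /andP[bL wL].
apply/allpairsP; exists (b, w); split => //=; last exact: IH.
by rewrite mem_iota b0 add1n ltnS.
Qed.

Lemma sum_words (R : realType) (v : nat -> R) (L n : nat) :
  \sum_(w <- words L n) \prod_(b <- w) v b = (\sum_(b <- iota 1 L) v b) ^+ n.
Proof.
elim: n => [|n IH]; first by rewrite big_seq1 big_nil expr0.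
rewrite /= big_allpairs_dep exprS -IH big_distrl /=; apply: eq_bigr => b _.
by rewrite big_distrr /=; apply: eq_bigr => w _; rewrite big_cons.
Qed.

Lemma sum_uniq_sub (R : realType) (T : eqType) (s1 s2 : seq T) (F : T -> R) :
  uniq s1 -> {subset s1 <= s2} -> (forall x, 0 <= F x) ->
  \sum_(x <- s1) F x <= \sum_(x <- s2) F x.
Proof.
move=> + + F0; elim: s1 s2 => [s2 _ _|x s1 IH s2 /= /andP[xs1 us1] sub].
  by rewrite big_nil sumr_ge0.
have xs2 : x \in s2 by apply: sub; rewrite mem_head.
rewrite big_cons (perm_big _ (perm_to_rem xs2)) big_cons lerD2l.
apply: IH => // y ys1; have : y \in s2 by apply: sub; rewrite inE ys1 orbT.
rewrite (perm_mem (perm_to_rem xs2)) inE => /predU1P[yx|//].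
by move: xs1; rewrite -yx ys1.
Qed.

(* Every [n >= n0] contributes at most [D / 2 ^ n]. *)
Lemma sum_good_words (R : realType) (v : nat -> R) (D S : R) (n0 : nat)
    (W : seq (seq nat)) :
  0 <= D -> 0 < S -> (forall b, 0 <= v b) ->
  (forall L, \sum_(b <- iota 1 L) v b <= S) ->
  uniq W -> (forall w, w \in W -> all (leq 1) w /\ (n0 <= size w)%N) ->
  \sum_(w <- W) D * (2 * S) ^- size w * \prod_(b <- w) v b <= 2 * D * 2^-1 ^+ n0.
Proof.
move=> D0 S0 v0 vS uW hW.
(* Finitely many words involve bounded letters and lengths, so [W] lies in a finite union of the
   lists [words L n], where (2 S)^-n S^n = 2^-n. *)
pose L := (\max_(w <- W) \max_(b <- w) b)%N.
pose N := (\max_(w <- W) size w).+1%N.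
pose F w := D * (2 * S) ^- size w * \prod_(b <- w) v b.
have F0 w : 0 <= F w.
  by rewrite /F !mulr_ge0 ?invr_ge0 ?exprn_ge0 ?prodr_ge0 ?mulr_ge0// ltW.
apply: (@le_trans _ _ (\sum_(w <- flatten [seq words L n | n <- iota n0 N]) F w)).
  apply: sum_uniq_sub => // w wW; have [w1 wn0] := hW w wW.
  apply/flattenP; exists (words L (size w)).
    apply/map_f; rewrite mem_iota wn0 /= /N addnS ltnS.
    apply: leq_trans (leq_addl _ _).
    exact: (@leq_bigmax_seq _ W (fun=> true) (@size nat) w wW).
  apply: mem_words => //; apply/allP => b bw /=.
  apply: leq_trans (@leq_bigmax_seq _ W (fun=> true)
    (fun w => \max_(b <- w) b)%N w wW isT).
  exact: (@leq_bigmax_seq _ w (fun=> true) (fun b => b) b bw).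
have size_words n w : w \in words L n -> size w = n.
  elim: n w => [|n IH] w /=; first by rewrite inE => /eqP ->.
  by case/allpairsP => -[b u] /= [_ /IH <- ->].
rewrite big_flatten big_map /=.
apply: (@le_trans _ _ (\sum_(n <- iota n0 N) D * 2^-1 ^+ n)).
  apply: ler_sum => n _.
  rewrite (eq_big_seq (fun w => D * (2 * S) ^- n * \prod_(b <- w) v b)); last first.
    by move=> w /size_words <-.
  rewrite -big_distrr /= sum_words -mulrA ler_wpM2l//.
  have -> : 2^-1 ^+ n = (2 * S) ^- n * S ^+ n :> R.
    by rewrite exprMn invfM -mulrA mulVf ?mulr1 ?exprVn// expf_neq0 ?gt_eqF.
  rewrite ler_wpM2l ?invr_ge0 ?exprn_ge0 ?mulr_ge0 ?(ltW S0)//.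
  by rewrite lerXn2r ?nnegrE ?sumr_ge0 ?(ltW S0).
rewrite -big_distrr /= -mulrA mulrCA ler_wpM2l//.
have -> : \sum_(n <- iota n0 N) 2^-1 ^+ n =
    2 * 2^-1 ^+ n0 - 2 * 2^-1 ^+ (n0 + N) :> R.
  elim: N => [|N' IH]; first by rewrite big_nil addn0 subrr.
  by rewrite -addn1 iotaD big_cat /= IH big_seq1 addn1 addnS exprS; field.
by rewrite lerBlDr lerDl mulr_ge0 ?exprn_ge0.
Qed.

Lemma large_letters (M : nat) (w : seq nat) : all (leq 1) w ->
  (size (undup w) <= M + count (fun b => M < b)%N w)%N.
Proof.
move=> /allP w1; rewrite -{1}(size_iota 1 M) -size_filter -size_cat.
apply: uniq_leq_size => [|b]; first exact: undup_uniq.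
rewrite mem_undup mem_cat mem_iota mem_filter => bw.
by rewrite bw (w1 b bw) /= add1n ltnS andbT; case: leqP.
Qed.

Lemma prod_powR (R : realType) (s : R) (w : seq nat) :
  (\prod_(b <- w) b%:R ^- 2) `^ s =
  \prod_(b <- w) (b%:R : R) `^ (- (2 * s)).
Proof.
elim: w => [|b w IH]; first by rewrite !big_nil powR1.
rewrite !big_cons powRM ?invr_ge0 ?exprn_ge0//; last first.
  by apply: prodr_ge0 => *; rewrite invr_ge0 exprn_ge0.
by rewrite IH -powR_invn// -powRrM mulNr.
Qed.

(* Chernoff bound: letters [> M] get the extra weight [t^-1], whose total over
   all such letters is still at most [1]. *)
Lemma letter_weights (R : realType) (s c : R) : 1 / 2 < s -> 0 < c ->
  exists S t : R, exists M : nat, exists v : nat -> R,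
  [/\ 0 < S, 0 < t <= 1, t `^ c = (2 * S)^-1,
      (forall b, (0 < b)%N ->
        v b = b%:R `^ (- (2 * s)) * (if (M < b)%N then t^-1 else 1)) &
      [/\ forall b, 0 <= v b & forall L, \sum_(b <- iota 1 L) v b <= S]].
Proof.
move=> s2 c0; pose eta := 2 * s - 1.
have eta0 : 0 < eta by rewrite /eta; lra.
have sE : 2 * s = 1 + eta by rewrite /eta; ring.
clearbody eta.
have ei : 0 < eta^-1 by rewrite invr_gt0.
(* 1 + 1/eta bounds the sum of b^(-1-eta) over all letters, and a further 1 is reserved for the
   reweighted large ones; so [S] and [t] are fixed before [M]. *)
pose S := 2 + eta^-1; have SE : S = 2 + eta^-1 by []; clearbody S.
have S0 : 0 < S by lra.
have q0 : 0 < (2 * S)^-1 <= 1 by rewrite invr_gt0 invf_le1; lra.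
pose t := (2 * S)^-1 `^ c^-1.
have tc : t `^ c = (2 * S)^-1 by rewrite /t powRVK//; lra.
have t0 : 0 < t by rewrite powR_gt0; lra.
have t1 : t <= 1.
  have := @le_powR R c^-1 _ 1 _ _ (andP q0).2; rewrite powR1; apply.
    by rewrite invr_ge0 ltW.
  by case/andP: q0 => /ltW.
clearbody t.
(* [M] is taken so large that the tail beyond it is at most [t]. *)
have [m hm] := natr_ge ((eta * t)^-1 `^ eta^-1).
pose M := m.+1.
have tail : M%:R `^ (- eta) / eta <= t.
  rewrite ler_pdivrMr// powRN mulrC -[leRHS]invrK lef_pV2 ?posrE; last 2 first.
  - by rewrite powR_gt0.
  - by rewrite invr_gt0 mulr_gt0.
  rewrite -(powRVK eta0 (_ : 0 <= (eta * t)^-1)); last first.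
    by rewrite invr_ge0 mulr_ge0 ?ltW.
  by apply: le_powR hm; [exact: ltW|exact: powR_ge0].
pose v (b : nat) : R := b%:R `^ (- (2 * s)) * (if (M < b)%N then t^-1 else 1).
exists S, t, M, v; split => //; first by rewrite t0 t1.
have v0 b : 0 <= v b.
  by rewrite /v mulr_ge0 ?powR_ge0//; case: ifP; rewrite // invr_ge0 ltW.
split => // L.
have sumE : \sum_(b <- iota 1 L) v b = \sum_(0 <= k < L) v k.+1.
  by rewrite -[1%N]addn0 iotaDl big_map /index_iota subn0.
rewrite sumE.
apply: (@le_trans _ _ (\sum_(0 <= k < M + L) v k.+1)).
  rewrite [leRHS](@big_cat_nat _ _ _ L)//= ?leq_addl// lerDl.
  by apply: sumr_ge0.
rewrite (@big_cat_nat _ _ _ M)//= ?leq_addr// SE.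
have h1 : \sum_(0 <= k < M) v k.+1 <= 1 + eta^-1.
  rewrite big_nat_recl// /v /=; apply: lerD.
    by rewrite powR1 mul1r.
  apply: (@le_trans _ _ (\sum_(1 <= k < 1 + m) k.+1%:R `^ (- (1 + eta)))).
    rewrite add1n big_add1 /= !big_nat; apply: ler_sum => k /andP[_ km].
    by rewrite sE ltnNge /M ltnS km /= mulr1.
  by apply: le_trans (powR_tail_le m eta0 (ltn0Sn 0)) _; rewrite powR1 mul1r.
have h2 : \sum_(M <= k < M + L) v k.+1 <= 1.
  apply: (@le_trans _ _ (t^-1 * \sum_(M <= k < M + L) k.+1%:R `^ (- (1 + eta)))).
    rewrite mulr_sumr !big_nat; apply: ler_sum => k /andP[Mk _].
    by rewrite /v sE ltnS Mk mulrC.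
  rewrite ler_pdivrMl// mulr1; apply: le_trans tail.
  exact: powR_tail_le.
by apply: le_trans (lerD h1 h2) _; lra.
Qed.

Definition good_word (R : realType) (c : R) (n0 : nat) (w : seq nat) : bool :=
  [&& all (leq 1) w, (n0 <= size w)%N & c * (size w)%:R <= (size (undup w))%:R].

(** With k letters above M, the right-hand side is the left-hand side times t^(c n - M - k), n being
    the length. The exponent is at most 0 by [large_letters], and t <= 1. *)
Lemma good_word_weight (R : realType) (s c S t : R) (M n0 : nat)
    (v : nat -> R) (w : seq nat) :
  0 < S -> 0 < t <= 1 -> t `^ c = (2 * S)^-1 ->
  (forall b, (0 < b)%N ->
    v b = b%:R `^ (- (2 * s)) * (if (M < b)%N then t^-1 else 1)) ->
  good_word c n0 w ->
  (\prod_(b <- w) b%:R ^- 2) `^ s <=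
  t ^- M * (2 * S) ^- size w * \prod_(b <- w) v b.
Proof.
move=> S0 t01 tc vE /and3P[w1 _ wc].
have t0 : 0 < t by lra.
rewrite prod_powR; set P := \prod_(b <- w) _ `^ _.
have P0 : 0 <= P by apply: prodr_ge0 => *; exact: powR_ge0.
pose k := count (fun b => M < b)%N w.
have -> : \prod_(b <- w) v b = P * t ^- k.
  rewrite /P /k; elim: w w1 {wc P P0 k} => [_|b w IH /= /andP[b0 w0]].
    by rewrite !big_nil expr0 invr1 mulr1.
  rewrite !big_cons IH// vE//; case: ifP => _; rewrite ?add0n ?add1n ?exprS ?invfM; ring.
have kc : c * (size w)%:R - M%:R <= k%:R.
  rewrite lerBlDr -natrD addnC; apply: le_trans wc _.
  by rewrite ler_nat large_letters.
rewrite mulrCA -[leLHS]mulr1 ler_wpM2l//.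
have tS : (2 * S) ^- size w = t `^ (c * (size w)%:R).
  by rewrite powRrM tc powR_mulrn ?invr_ge0 ?exprVn ?mulr_ge0 ?ltW.
rewrite tS -!powR_invn ?(ltW t0)// -!powRD ?(gt_eqF t0) ?implybT//.
rewrite -[leLHS](powRr0 t); apply: ger_powR => //; lra.
Qed.

Lemma F_set_eventually (R : realType) (c x : R) (n0 : nat) : 0 < c ->
  F_set c x -> exists n, good_word (c / 2) n0 (mkseq (cf_seq x) n).
Proof.
move=> c0 [x01 [xi /cvgrPdist_le lim]].
have c2 : 0 < c / 2 by lra.
have [N _ hN] := lim _ c2.
pose n := maxn N (maxn n0 1); exists n.
have nN : (N <= n)%N by rewrite leq_maxl.
have nn0 : (n0 <= n)%N by rewrite /n !leq_max leqnn orbT.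
have n1 : (0 < n)%N by rewrite /n !leq_max ltnSn !orbT.
apply/and3P; split.
- by apply/allP => _ /mapP[k _ ->]; exact: (cf_digit_gauss k xi x01).1.
- by rewrite size_mkseq.
- rewrite size_mkseq.
  have -> : size (undup (mkseq (cf_seq x) n)) = cf_distinct x n.
    by rewrite /cf_distinct /mkseq -[1%N]addn0 iotaDl -map_comp.
  have np : (0 : R) < n%:R by rewrite ltr0n.
  have := hN n nN; rewrite /= powRr1 ?(ltW np)// ler_norml => /andP[_ h].
  rewrite -ler_pdivlMr//; lra.
Qed.

Lemma F_set_cover (R : realType) (c s e : R) : 0 < c -> 1 / 2 < s <= 1 -> 0 < e ->
  exists U : nat -> set R,
    [/\ F_set c `<=` \bigcup_i U i, forall i, (diam (U i) <= e%:E)%E &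
      (\sum_(0 <= i <oo) hcost s (U i) <= e%:E)%E].
Proof.
move=> c0 s01 e0; have c2 : 0 < c / 2 by lra.
have s2 : 1 / 2 < s by lra.
have [S [t [M [v [S0 t01 tc vE [v0 vS]]]]]] := letter_weights s2 c2.
have t0 : 0 < t by lra.
have D0 : 0 < t ^- M by rewrite invr_gt0 exprn_gt0.
have [n0 hn0] := half_pow_small (divr_gt0 e0 (mulr_gt0 (ltr0n R 2 : 0 < 2) D0)).
have {}hn0 : 2 * t ^- M * 2^-1 ^+ n0 <= e.
  by rewrite mulrC -ler_pdivlMr// mulr_gt0.
pose good := good_word (c / 2) n0.
pose G w := t ^- M * (2 * S) ^- size w * \prod_(b <- w) v b.
have G0 w : 0 <= G w.
  by rewrite /G !mulr_ge0 ?invr_ge0 ?exprn_ge0 ?prodr_ge0 ?mulr_ge0// ltW.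
(* Words are enumerated through [pickle]; an index coding no good word receives the empty set, of
   cost 0. *)
pose U i := if pickle_inv i is Some w then
  if good w then @cylinder R w else set0 else set0.
pose u i : R := if pickle_inv i is Some w then if good w then G w else 0 else 0.
have u0 i : 0 <= u i.
  by rewrite /u; case: pickle_inv => // w; case: ifP.
have sum_u N : \sum_(i < N) u i <= e.
  apply: le_trans hn0.
  pose W := [seq w <- pmap (@pickle_inv (seq nat)) (iota 0 N) | good w].
  have -> : \sum_(i < N) u i = \sum_(w <- W) G w.
    rewrite big_filter -(big_mkord xpredT u) /index_iota subn0.
    elim: (iota 0 N) => [|i I IH]; first by rewrite !big_nil.
    rewrite big_cons IH /u /=; case: (pickle_inv i) => [w|] /=.
      by rewrite big_cons; case: ifP => // _; rewrite add0r.
    by rewrite add0r.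
  apply: (@sum_good_words R v (t ^- M) S n0 W (ltW D0) S0 v0 vS).
    by rewrite filter_uniq// (pmap_uniq (@pickle_invK _)) ?iota_uniq.
  by move=> w; rewrite mem_filter => /andP[/and3P[? ? _] _].
have cost i : exists2 d : R, 0 <= d <= 1 /\ (diam (U i) <= d%:E)%E & d `^ s <= u i.
  rewrite /U /u; case: pickle_inv => [w|]; last first.
    exists 0; last by rewrite powR0//; apply: lt0r_neq0; lra.
    by split; [rewrite lexx ler01|apply: diam_le].
  case: ifP => gw; last first.
    exists 0; last by rewrite powR0//; apply: lt0r_neq0; lra.
    by split; [rewrite lexx ler01|apply: diam_le].
  have /and3P[w1 _ _] := gw.
  exists (\prod_(b <- w) b%:R ^- 2); last exact: good_word_weight gw.
  split; last exact: diam_cylinder.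
  elim: w w1 {gw} => [_|b w IH /= /andP[b0 w0]]; first by rewrite big_nil ler01 lexx.
  rewrite big_cons; have /andP[p0 p1] := IH w0.
  have b1 : (1 : R) <= b%:R by rewrite ler1n.
  have b2 : 1 <= b%:R ^+ 2 :> R by rewrite exprn_ege1.
  have bi : 0 <= (b%:R : R) ^- 2 <= 1.
    apply/andP; split; first by rewrite invr_ge0 exprn_ge0.
    by rewrite invf_le1 ?exprn_gt0//; lra.
  by apply/andP; split; nra.
exists U; split.
- move=> x Fx; have [n gn] := F_set_eventually n0 c0 Fx.
  exists (pickle (mkseq (cf_seq x) n)) => //.
  rewrite /U pickleK_inv -/good /good gn.
  have [x01 [xi _]] := Fx.
  exists (iter n (@gauss R) x); last by rewrite -cfval_cf_seq.
  by have [_ /andP[z0 /ltW z1]] := gauss_iter_itv n xi x01; rewrite /= z0 z1.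
(* As d <= 1 and s <= 1, d <= d^s, so the bound on the cost bounds the diameter as well. *)
- move=> i; have [d [d01 dU] du] := cost i.
  apply: le_trans dU _; rewrite lee_fin.
  have ui : u i <= e.
    by apply: le_trans (sum_u i.+1); rewrite big_ord_recr /= lerDr sumr_ge0.
  apply: le_trans ui; apply: le_trans du.
  have [->|dn] := eqVneq d 0; first exact: powR_ge0.
  by apply: ger1_powR; [rewrite lt_neqAle eq_sym dn|]; lra.
- apply: (@hcost_series_le _ _ _ _ u) => // i.
  have [d [d01 dU] du] := cost i.
  apply: (@le_trans _ _ (d `^ s)%:E); last by rewrite lee_fin.
  by apply: hcost_le => //; lra.
Qed.

Theorem theorem2 (R : realType) :
  (forall beta c : R, 0 < beta < 1 -> 0 < c ->
     hausdorff_dim (E_set beta c) = 1%:E) /\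
  (forall c : R, 0 < c <= 1 -> hausdorff_dim (F_set c) = (1 / 2)%:E).
Proof.
split=> [beta c b01 c0|c c01]; apply/eqP; rewrite eq_le; apply/andP; split.
- by apply: hausdorff_dim_unit => x [].
- apply: hausdorff_dim_ge => // s s01.
  have [e e0 he] := E_set_mass b01 c0 s01.
  by exists e => // U EU _; exact: he.
- have c0 : 0 < c by lra.
  apply: hausdorff_dim_le; first lra.
  (* For dimension 1/2 the cap on [s] is 1, as the cover requires. *)
  by move=> s e s12 e0; apply: F_set_cover => //; lra.
- apply: hausdorff_dim_ge; first lra.
  move=> s s12; have [e e0 he] := F_set_mass c01 s12.
  by exists e => // U EU _; exact: he.
Qed.
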